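(* Let $(M,\,{}^0T'',\zeta)$ be a normal strongly pseudoconvex CR-manifold with $\dim_{\mathbb R}M=2n-1\ge 7$ whose canonical line bundle $K_M=\wedge^n(T')^*$ is trivial in the CR-sense, with a fixed nowhere vanishing section $\omega\in\Gamma(M,\wedge^n(T')^* )$ satisfying $d''\omega=0$. If $\alpha,\beta\in A^{n-2,1}(M)$ and $\rho\in\Gamma(M,\wedge^{\bullet}(T')^* )$, then $$[\imath_1^{-1}\alpha,\imath_1^{-1}\beta]\lrcorner\rho=\imath_1^{-1}\alpha\lrcorner d'(\imath_1^{-1}\beta\lrcorner\rho)+\imath_1^{-1}\beta\lrcorner d'(\imath_1^{-1}\alpha\lrcorner\rho)-d'\bigl(\imath_1^{-1}\beta\lrcorner(\imath_1^{-1}\alpha\lrcorner\rho)\bigr)-\imath_1^{-1}\beta\lrcorner(\imath_1^{-1}\alpha\lrcorner d'\rho).$$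
   Context: **CR-manifold.** $M$ is a compact orientable $C^\infty$ manifold of real dimension $2n-1$, and ${}^0T''\subset\mathbb C\otimes TM$ is a complex subbundle of rank $n-1$ with ${}^0T''\cap{}^0\overline T''=0$ (where ${}^0\overline T''=\overline{{}^0T''}$) and $[\Gamma(U,{}^0T''),\Gamma(U,{}^0T'')]\subset\Gamma(U,{}^0T'')$ for every open $U\subseteq M$. **Normal strongly pseudoconvex.** $\zeta$ is a global real vector field on $M$ with $\zeta_p\notin{}^0T''_p+{}^0\overline T''_p$ for every $p\in M$ and $[\zeta,\Gamma(M,{}^0T'')]\subseteq\Gamma(M,{}^0T'')$. Thus $\mathbb C\otimes TM={}^0T''\oplus{}^0\overline T''\oplus\mathbb C\zeta$. The Levi form $L(X,Y)=-\sqrt{-1}\,[X,\overline Y]_{\mathbb C\zeta}$, $X,Y\in{}^0T''$ (the $\mathbb C\zeta$-component in this decomposition), is assumed to be (positive or negative) definite at each point. Subscripts such as $[\cdot,\cdot]_{{}^0T''}$ denote components with respect to this decomposition. Put $T'={}^0\overline T''+\mathbb C\zeta$. The dual bundles $({}^0T'')^*$, $({}^0\overline T'')^*$, $(\mathbb C\zeta)^*$, $(T')^*$ are regarded as bundles of complex $1$-forms on $M$ via the decomposition. **Forms and operators.** $A^{p,q}(M)=\Gamma\bigl(M,(\mathbb C\zeta)^*\wedge\wedge^p({}^0\overline T'')^*\wedge\wedge^q({}^0T'')^*\bigr)$. For $u\in A^{p,q}(M)$, $d'u$ is the component of $du$ in $(\mathbb C\zeta)^*\wedge\wedge^{p+1}({}^0\overline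 T'')^*\wedge\wedge^q({}^0T'')^*$, and $d''u$ is the component of $du$ in $(\mathbb C\zeta)^*\wedge\wedge^p({}^0\overline T'')^*\wedge\wedge^{q+1}({}^0T'')^*$. For a section $u$ of $\wedge^p({}^0\overline T'')^*\wedge\wedge^q({}^0T'')^*$ (no $(\mathbb C\zeta)^*$-factor), $d'u$ is likewise the component of $du$ in $\wedge^{p+1}({}^0\overline T'')^*\wedge\wedge^q({}^0T'')^*$. The operator $d'$ is extended additively to sums of forms of different types. **Trivial in the CR-sense.** $K_M=\wedge^n(T')^*$ is trivial in the CR-sense if it has a nowhere vanishing global section $\omega$ with $d''\omega=0$. **Contraction and $\imath_q$.** For a vector field $X$ in $T'$ and a section $\eta$ of $\wedge^q({}^0T'')^*$, the contraction of a form $\rho$ by $X\otimes\eta$ is $(X\otimes\eta)\lrcorner\rho=\eta\wedge(X\lrcorner\rho)$, where $X\lrcorner$ is interior multiplication; this is extended linearly. The bundle isomorphism $\imath_q:T'\otimes\wedge^q({}^0T'')^*\to\wedge^{n-1}(T')^*\wedge\wedge^q({}^0T'')^*$ is $\imath_q(u)=u\lrcorner\omega$. It restricts to an isomorphism of ${}^0\overline T''\otimes\wedge^q({}^0T'')^*$ onto $(\mathbb C\zeta)^*\wedge\wedge^{n-2}({}^0\overline T'')^*\wedge\wedge^q({}^0T'')^*$, so $\imath_1^{-1}\alpha\in\Gamma(M,{}^0\overline T''\otimes({}^0T'')^* )$ for $\alpha\in A^{n-2,1}(M)$. **Bracket.** For $\phi,\psi\in\Gamma(M,{}^0\overline T''\otimes({}^0T'')^*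 )$, the bracket $[\phi,\psi]\in\Gamma(M,{}^0\overline T''\otimes\wedge^2({}^0T'')^* )$ is defined, for $X,Y\in\Gamma(M,{}^0T'')$, by $$[\phi,\psi](X,Y)=[\phi(X),\psi(Y)]+[\psi(X),\phi(Y)]-\phi\bigl([X,\psi(Y)]_{{}^0T''}+[\psi(X),Y]_{{}^0T''}\bigr)-\psi\bigl([\phi(X),Y]_{{}^0T''}+[X,\phi(Y)]_{{}^0T''}\bigr).$$ The wedge product is normalized so that $(\eta_1\wedge\eta_2)(X,Y)=\eta_1(X)\eta_2(Y)-\eta_1(Y)\eta_2(X)$ for $1$-forms. *)

(* Defs.v *)
From HB Require Import structures.
From mathcomp Require Import all_boot all_order all_algebra.
From mathcomp Require Import complex.
From mathcomp Require Import all_classical all_reals all_analysis.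

Set Implicit Arguments.
Unset Strict Implicit.
Unset Printing Implicit Defensive.

Import Order.TTheory GRing.Theory Num.Theory numFieldNormedType.Exports.

Local Open Scope classical_set_scope.
Local Open Scope ring_scope.

Section euclidean.
Variables (R : realType) (m : nat).
Implicit Types (W : set 'rV[R]_m) (x v : 'rV[R]_m).

Definition iter_derive (vs : seq 'rV[R]_m) (g : 'rV[R]_m -> R^o) :
    'rV[R]_m -> R^o :=
  foldr (fun v h x => 'D_v h x) g vs.

(* C^oo on W: every iterated directional derivative is (Frechet)
   differentiable at every point of W; used with W open. *)
Definition smooth_on W (g : 'rV[R]_m -> R^o) :=
  forall vs x, W x -> differentiable (iter_derive vs g) x.

Definition cderive (g : 'rV[R]_m -> R[i]) v x : R[i] :=
  Complex ('D_v (fun y => complex.Re (g y) : R^o) x)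
          ('D_v (fun y => complex.Im (g y) : R^o) x).

End euclidean.

(* cmap is only meaningful on chart_dom, and cinv only on its image. *)
Record chart (R : realType) (m : nat) (M : Type) := Chart {
  chart_dom : set M;
  cmap : M -> 'rV[R]_m;
  cinv : 'rV[R]_m -> M }.

Section charts.
Variables (R : realType) (m : nat) (M : topologicalType).
Implicit Types c : chart R m M.

Definition chart_cod c : set 'rV[R]_m := cmap c @` chart_dom c.

Definition is_chart c :=
  [/\ open (chart_dom c), open (chart_cod c),
      forall p, chart_dom c p -> cinv c (cmap c p) = p,
      forall p, chart_dom c p -> {for p, continuous (cmap c)} &
      forall x, chart_cod c x -> {for x, continuous (cinv c)}].

Definition transition c c' : 'rV[R]_m -> 'rV[R]_m := cmap c' \o cinv c.

Definition smooth_transition c c' :=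
  forall i, smooth_on (cmap c @` (chart_dom c `&` chart_dom c'))
                      (fun x => transition c c' x 0 i).

(* Atlases are indexed by the points of M, with p in the domain of c p; a
   general atlas is brought to this form by choosing a chart around every
   point, which does not change the smooth structure. *)
Definition smooth_atlas (c : M -> chart R m M) :=
  (forall p, is_chart (c p) /\ chart_dom (c p) p) /\
  (forall p q, smooth_transition (c p) (c q)).

Definition oriented_atlas (c : M -> chart R m M) :=
  forall p q x, (cmap (c p) @` (chart_dom (c p) `&` chart_dom (c q))) x ->
    0 < \det ('J (transition (c p) (c q)) x).

End charts.

Record manifold (R : realType) (m : nat) := Manifold {
  carrier :> topologicalType;
  chart_at : carrier -> chart R m carrier;
  manifold_hausdorff : hausdorff_space carrier;
  manifold_atlas : smooth_atlas chart_at }.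
Arguments chart_at {R m M} p : rename.

Definition orientable (R : realType) (m : nat) (M : manifold R m) :=
  exists c : M -> chart R m M,
    [/\ smooth_atlas c, oriented_atlas c &
        forall p q : M, smooth_transition (chart_at p) (c q) /\
                        smooth_transition (c q) (chart_at p)].

Section calculus.
Variables (R : realType) (m : nat) (M : manifold R m).

Local Notation C := R[i].

(* The fibre of C (x) TM at p is identified with C^m through the coordinate
   basis of the chart chart_at p, so that complex conjugation is
   componentwise.  Such a family of vectors need not be smooth. *)
Definition vector_field := M -> 'rV[C]_m.

Implicit Types (U V : set M) (f : M -> C) (X Y : vector_field).
Implicit Types s : seq vector_field.

Definition smooth_fun U f :=
  forall p : M, let c := chart_at p in
    let W := [set x | chart_cod c x /\ U (cinv c x)] in
    smooth_on W (fun x => complex.Re (f (cinv c x))) /\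
    smooth_on W (fun x => complex.Im (f (cinv c x))).

Definition vact X f : M -> C := fun p => let c := chart_at p in
  \sum_(i < m) X p 0 i * cderive (f \o cinv c) (delta_mx 0 i) (cmap c p).

Definition smooth_field U X :=
  forall V f, open V -> V `<=` U -> smooth_fun V f -> smooth_fun V (vact X f).

Definition coord (p : M) (i : 'I_m) : M -> C :=
  fun q => Complex (cmap (chart_at p) q 0 i) 0.

(* The i-th component of [X, Y] at p is X (Y x_i) - Y (X x_i), where the x_i
   are the coordinates of the chart at p. *)
Definition lie_bracket X Y : vector_field := fun p =>
  \row_i (vact X (vact Y (coord p i)) p - vact Y (vact X (coord p i)) p).

Definition conj_field X : vector_field := fun p => map_mx conjc (X p).

(* A family of subspaces of the fibres; E p stands for its row space. *)
Definition subspaces := M -> 'M[C]_m.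

Definition conj_subspaces (E : subspaces) : subspaces :=
  fun p => map_mx conjc (E p).

Definition section_over U (E : subspaces) X :=
  smooth_field U X /\ forall p, U p -> (X p <= E p)%MS.

Definition subbundle (r : nat) (E : subspaces) :=
  forall p, exists2 U, open_nbhs p U &
    exists X : 'I_r -> vector_field, (forall i, smooth_field U (X i)) /\
      forall q, U q -> let F := \matrix_(i < r) X i q in
        row_free F /\ (E q == F)%MS.

(* Differential forms.  Sections of a bundle of forms are represented by the
   corresponding C^oo(M)-multilinear maps on global smooth vector fields.  A
   form is a function on finite sequences of vector fields, so that its
   restriction to the sequences of length k is its component of degree k.
   Only the values on sequences of smooth fields are meaningful. *)

Definition smooth_fields s :=
  forall i, (i < size s)%N -> smooth_field setT s`_i.

Definition fscale (V : lmodType C) f (X : M -> V) : M -> V :=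
  fun p => f p *: X p.

Definition alternating (V : lmodType C) (u : seq vector_field -> M -> V) :=
  (forall f X Y s1 s2, smooth_fun setT f ->
     smooth_fields (s1 ++ X :: Y :: s2) ->
     u (s1 ++ (fscale f X + Y) :: s2) =
       fscale f (u (s1 ++ X :: s2)) + u (s1 ++ Y :: s2)) /\
  (forall X s1 s2 s3, smooth_fields (s1 ++ X :: s2 ++ X :: s3) ->
     u (s1 ++ X :: s2 ++ X :: s3) = 0).

Definition diff_form := seq vector_field -> M -> C.

Implicit Types w r : diff_form.

Definition is_form w :=
  alternating (w : seq vector_field -> M -> C^o) /\
  forall s, smooth_fields s -> smooth_fun setT (w s).

Definition has_degree (V : zmodType) (k : nat)
    (u : seq vector_field -> M -> V) :=
  forall s, smooth_fields s -> size s != k -> u s = 0.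

Definition annihilated_by (V : zmodType) (E : subspaces)
    (u : seq vector_field -> M -> V) :=
  forall s i, smooth_fields s -> (i < size s)%N -> section_over setT E s`_i ->
    u s = 0.

Definition eq_form w r := forall s, smooth_fields s -> w s = r s.

Definition drop_nth i s := take i s ++ drop i.+1 s.

Definition dform w : diff_form := fun s =>
  \sum_(i < size s) (-1) ^+ i *: vact s`_i (w (drop_nth i s))
  + \sum_(i < size s) \sum_(j < size s | (i < j)%N)
      (-1) ^+ (i + j) *: w (lie_bracket s`_i s`_j :: drop_nth i (drop_nth j s)).

Definition interior_mult X w : diff_form := fun s => w (X :: s).

(* A mask b with q marks selects q of the arguments s; together with the
   complementary mask it encodes a (q, size s - q)-shuffle, whose sign is
   given by the parity of inversions b. *)
Definition inversions (b : seq bool) : nat :=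
  (\sum_(i < size b) \sum_(j < size b | i < j)
    (~~ nth false b i && nth false b j))%N.

Definition shuffle_sum (q : nat)
    (F : seq vector_field -> seq vector_field -> M -> C) : diff_form :=
  fun s => \sum_(b : (size s).-tuple bool | count id b == q)
    (-1) ^+ inversions b *: F (mask b s) (mask [seq ~~ x | x <- b] s).

(* The exterior product of the q-form w with r. *)
Definition wedge_form (q : nat) w r : diff_form :=
  shuffle_sum q (fun s1 s2 => w s1 * r s2).

(* Vector-valued forms; X (x) w is represented by s |-> w(s) X. *)
Definition vform := seq vector_field -> vector_field.

Definition vtensor X w : vform := fun s => fscale (w s) X.

(* The contraction of r by the vector-valued q-form u: it is additive in u
   (contract_formD), and for u = X (x) w it is
   wedge_form q w (interior_mult X r) (contract_form_tensor). *)
Definition contract_form (q : nat) (u : vform) r : diff_form :=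
  shuffle_sum q (fun s1 s2 => r (u s1 :: s2)).

(* Sections of E (x) wedge^q (F^o), where F^o is the annihilator of F. *)
Definition vform_section (E F : subspaces) (q : nat) (u : vform) :=
  [/\ alternating u,
      forall s, smooth_fields s -> section_over setT E (u s),
      has_degree q u &
      annihilated_by F u].

Lemma smooth_on_cst (W : set 'rV[R]_m) (a : R) : smooth_on W (fun=> a).
Proof.
move=> vs x _; have [b ->] : exists b, iter_derive vs (fun=> a) = (fun=> b).
  elim: vs => [|v vs [b IH]]; first by exists a.
  by exists 0; apply/funext => y /=; rewrite IH derive_cst.
exact: differentiable_cst.
Qed.

Lemma smooth_fun1 : smooth_fun setT (fun=> 1).
Proof. by move=> p; split; exact: smooth_on_cst. Qed.

Lemma smooth_field0 : smooth_field setT 0.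
Proof.
move=> V f _ _ _; suff -> : vact 0 f = (fun=> 0).
  by move=> p; split; exact: smooth_on_cst.
by apply/funext => p; rewrite /vact big1// => i _; rewrite mxE mul0r.
Qed.

Lemma smooth_fields_cons X s :
  smooth_fields (X :: s) <-> smooth_field setT X /\ smooth_fields s.
Proof.
split=> [Xs|[XX ss] [|i]//]; last exact: ss.
by split=> [|i si]; [exact: (Xs 0%N)|exact: (Xs i.+1)].
Qed.

Lemma smooth_fields_mask b s : smooth_fields s -> smooth_fields (mask b s).
Proof.
elim: s b => [|X s IH] [|[] b]//= /smooth_fields_cons[XX ss]; last exact: IH.
by apply/smooth_fields_cons; split=> //; exact: IH.
Qed.

Lemma eq_shuffle_sum q F G s : smooth_fields s ->
  (forall s1 s2, smooth_fields s1 -> smooth_fields s2 -> F s1 s2 = G s1 s2) ->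
  shuffle_sum q F s = shuffle_sum q G s.
Proof.
move=> ss FG; apply: eq_bigr => b _.
by rewrite FG//; exact: smooth_fields_mask.
Qed.

Lemma contract_formD q (E F : subspaces) u v r :
  vform_section E F q u -> vform_section E F q v -> is_form r ->
  eq_form (contract_form q (u + v) r)
    (contract_form q u r + contract_form q v r).
Proof.
move=> [_ uE _ _] [_ vE _ _] [[rlin _] _] s ss.
transitivity (shuffle_sum q (fun s1 s2 => r (u s1 :: s2) + r (v s1 :: s2)) s).
  apply: eq_shuffle_sum => // s1 s2 ss1 ss2.
  have := rlin (fun=> 1) (u s1) (v s1) [::] s2 smooth_fun1.
  rewrite /fscale /=.
  have -> : (fun p => 1 *: u s1 p) = u s1.
    by apply/funext => p; rewrite scale1r.
  have -> : (fun p => 1 *: (r (u s1 :: s2) p : C^o)) = r (u s1 :: s2).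
    by apply/funext => p; rewrite scale1r.
  apply; apply/smooth_fields_cons; split; first by have [] := uE _ ss1.
  by apply/smooth_fields_cons; split=> //; have [] := vE _ ss1.
rewrite -[RHS]/(contract_form q u r s + contract_form q v r s).
rewrite /contract_form /shuffle_sum -big_split /=.
by apply: eq_bigr => b _; rewrite scalerDr.
Qed.

Lemma contract_form_tensor q X w r :
  smooth_field setT X -> is_form w -> is_form r ->
  eq_form (contract_form q (vtensor X w) r)
    (wedge_form q w (interior_mult X r)).
Proof.
move=> XX [_ wsm] [[rlin _] _] s ss; apply: eq_shuffle_sum => // s1 s2 ss1 ss2.
have r0 : r (0 :: s2) = 0.
  have := rlin (fun=> 1) 0 0 [::] s2 smooth_fun1.
  rewrite /fscale /= => H.
  have {H} := H _; have sm0 : smooth_fields (0 :: 0 :: s2).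
    by do 2![apply/smooth_fields_cons; split; first exact: smooth_field0].
  move=> /(_ sm0).
  have -> : (fun p : M => 1 *: (0 : vector_field) p) + 0 = 0.
    by rewrite addr0; apply/funext => p; rewrite scaler0.
  have -> : (fun p => 1 *: (r (0 :: s2) p : C^o)) = r (0 :: s2).
    by apply/funext => p; rewrite scale1r.
  by move=> /esym/eqP; rewrite -subr_eq0 addrK => /eqP.
have := rlin (w s1) X 0 [::] s2 (wsm _ ss1).
rewrite /= addr0 r0 addr0; apply.
by do 2![apply/smooth_fields_cons; split=> //; try exact: smooth_field0].
Qed.

Lemma wedge_form11 w r X Y :
  wedge_form 1 w r [:: X; Y] = w [:: X] * r [:: Y] - w [:: Y] * r [:: X].
Proof.
rewrite /wedge_form /shuffle_sum.
have E a b : inversions [:: a; b] = ~~ a && b :> nat.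
  rewrite /inversions !big_ord_recl !big_ord0 /=.
  rewrite big_mkcond !big_ord_recl !big_ord0 /= ?addn0 ?add0n.
  by rewrite big_pred0 ?addn0// => -[[|[|//]]].
rewrite (bigD1 [tuple true; false])//= (bigD1 [tuple false; true])//= big1.
  by rewrite !E expr0 expr1 scale1r scaleN1r addr0.
move=> [[|a [|b [|//]]]//= sz] /andP[/andP[/eqP ab]].
by case: a b sz ab => [] [].
Qed.

End calculus.

Section cr.
Variables (R : realType) (n m : nat) (M : manifold R m).
Variables (T0 : subspaces M) (zeta : vector_field M).

Local Notation C := R[i].
Implicit Types (X Y : vector_field M) (s : seq (vector_field M)).
Implicit Types w r u : diff_form M.

Definition cr_structure :=
  [/\ compact [set: M], orientable M, subbundle n.-1 T0,
      forall p, (T0 p :&: conj_subspaces T0 p)%MS = 0 &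
      forall U X Y, open U -> section_over U T0 X -> section_over U T0 Y ->
        section_over U T0 (lie_bracket X Y)].

(* The decomposition of the complexified tangent bundle. *)
Definition iZ : 'I_3 := @Ordinal 3 0 isT.
Definition iB : 'I_3 := @Ordinal 3 1 isT.
Definition iT : 'I_3 := @Ordinal 3 2 isT.

Definition summand (k : 'I_3) : subspaces M := fun p =>
  match val k with
  | 0 => <<zeta p>>%MS
  | 1 => conj_subspaces T0 p
  | _ => T0 p
  end.

Definition project (k : 'I_3) X : vector_field M := fun p =>
  X p *m proj_mx (summand k p) (\sum_(j < 3 | j != k) summand j p)%MS.

Definition Tprime : subspaces M := fun p =>
  (conj_subspaces T0 p + zeta p)%MS.

Definition levi X Y : vector_field M := fun p =>
  - 'i%C *: project iZ (lie_bracket X (conj_field Y)) p.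

(* The Levi form is tensorial: its value at p is computed with sections of T0
   over a neighbourhood of p.  In R[i], 0 < a means that a is a positive real
   number. *)
Definition levi_definite_at (p : M) :=
  let sign_on (P : C -> Prop) := forall U X, open U -> U p ->
    section_over U T0 X -> X p != 0 ->
    exists2 a : C, P a & levi X X p = a *: zeta p in
  sign_on (fun a => 0 < a) \/ sign_on (fun a => a < 0).

Definition normal_strongly_pseudoconvex :=
  [/\ smooth_field setT zeta, conj_field zeta = zeta,
      forall p, ~~ (zeta p <= T0 p + conj_subspaces T0 p)%MS,
      forall X, section_over setT T0 X ->
        section_over setT T0 (lie_bracket zeta X) &
      forall p, levi_definite_at p].

(* The component of w in wedge^a (C zeta)^* /\ wedge^p (bar T0)^* /\
   wedge^q T0^*: the part of w (sum of the projections of the arguments) in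
   which a, p and q arguments are projected to C zeta, bar T0 and T0. *)
Definition component (a p q : nat) w : diff_form M := fun s =>
  \sum_(t : {ffun 'I_(size s) -> 'I_3} |
          [&& #|[pred i | t i == iZ]| == a, #|[pred i | t i == iB]| == p &
              #|[pred i | t i == iT]| == q])
    w [seq project (t i) s`_i | i <- enum 'I_(size s)].

Definition of_type (a p q : nat) w :=
  is_form w /\ eq_form (component a p q w) w.

Definition Apq (p q : nat) w := of_type 1 p q w.

(* On arguments s only the finitely many types with p, q < size s can
   contribute. *)
Definition dprime w : diff_form M := fun s =>
  \sum_(a < 2) \sum_(p < size s) \sum_(q < size s)
    component a p.+1 q (dform (component a p q w)) s.

Definition dsecond w : diff_form M := fun s =>
  \sum_(p < size s) \sum_(q < size s)
    component 1 p q.+1 (dform (component 1 p q w)) s.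

(* Sections of wedge^. (T')^* *)
Definition Tprime_form w := is_form w /\ annihilated_by T0 w.

Definition trivializing_section w :=
  [/\ Tprime_form w, has_degree n w,
      forall p, exists2 s, smooth_fields s & w s p != 0 &
      eq_form (dsecond w) 0].

Definition imath (omega : diff_form M) (q : nat) (u : vform M) : diff_form M :=
  contract_form q u omega.

(* The inverse of the isomorphism induced by imath from
   bar T0 (x) wedge^q T0^* onto
   (C zeta)^* /\ wedge^(n-2) (bar T0)^* /\ wedge^q T0^*
   (with the dummy value 0 outside its range). *)
Definition imath_inv (omega : diff_form M) (q : nat) w : vform M :=
  xget (0 : seq (vector_field M) -> M -> 'rV[C]_m)
    [set u | vform_section (conj_subspaces T0) Tprime q u /\
             eq_form (imath omega q u) w].

(* The arguments are projected to T0 because T0^* is regarded as a bundle of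
   forms on M. *)
Definition vbracket (phi psi : vform M) : vform M := fun s =>
  if s is [:: V; W] then
    let X := project iT V in let Y := project iT W in
    let phi1 Z := phi [:: Z] in let psi1 Z := psi [:: Z] in
    (lie_bracket (phi1 X) (psi1 Y) + lie_bracket (psi1 X) (phi1 Y)
     - phi1 (project iT (lie_bracket X (psi1 Y))
             + project iT (lie_bracket (psi1 X) Y))
     - psi1 (project iT (lie_bracket (phi1 X) Y)
             + project iT (lie_bracket X (phi1 Y)))
     : M -> 'rV[C]_m)
  else 0 : M -> 'rV[C]_m.

End cr.

(* Main.v *)
(* The component d' of the exterior differential d that adds one argument of
   type bar T0 is itself given by Cartan's formula, for the anchor sending X to
   its bar T0-part B X and for a bracket [X, Y]' (which need not satisfy the Jacobi
   identity) made of components of [B X, Y] and [X, B Y].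

   Writing i_A for the contraction by a vector-valued 1-form A, one has
   [i_X, d']_+ = L_X, [i_X, i_A] = i_(A X) and [i_A, i_B] = i_(BA - AB).  For phi
   and psi with phi psi = psi phi = 0, an induction on the degree then shows that
   [[i_phi, d'], i_psi] is the contraction by the Frolicher-Nijenhuis bracket of
   phi and psi taken with respect to [ , ]'.  As phi and psi map T0 to bar T0 and
   vanish on T', and as bar T0 is integrable, this bracket is the one of the
   statement.  The preimages phi and psi of alpha and beta enter only through
   this property, which also holds for the dummy value of imath_inv.

   Forms are only meaningful on smooth fields, so the projections to the summands
   and the Lie bracket must preserve smoothness; for the bracket this rests on
   the symmetry of second derivatives. *)

(* The formal part takes place over abelian groups: of forms it asks additivity in each argument and
   skew-symmetry, of the anchor and the bracket biadditivity, and of the bracket also antisymmetry.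
   Its identities are then equalities of integer combinations of terms, settled by comparing
   coefficients.

   The obstacle is that every operation is given by an explicit sum: over positions for [d], over
   shuffles for contractions, over type assignments for components. Each is first rewritten as a
   recursion on the head argument, in which the rules for [i_X] hold by computation.

   The recursive description of [d'] is compared with the given one on arguments of pure types,
   where a component either keeps the whole value or is zero. This comparison needs forms to vanish
   on two arguments in [C zeta], because [d'] sums over the types with at most one [zeta] factor;
   here linearity over functions and the fact that [C zeta] is a line enter. *)
From HB Require Import structures.
Require Import Defs.
From mathcomp Require Import all_boot all_order all_algebra.
From mathcomp Require Import complex ring.
From mathcomp Require Import all_classical all_reals all_analysis.

Set Implicit Arguments.
Unset Strict Implicit.
Unset Printing Implicit Defensive.

Import Order.TTheory GRing.Theory Num.Theory numFieldNormedType.Exports.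

Local Open Scope classical_set_scope.
Local Open Scope ring_scope.

(** * Calculus on manifolds *)

(** The differential of [f] gives a first-order expansion of [g] as well, and uniqueness of such an
    expansion makes it the differential of [g]. *)
Lemma near_eq_differentiable (R : numFieldType) (V W : normedModType R)
    (f g : V -> W) (x : V) : (\near x, f x = g x) ->
  differentiable f x -> differentiable g x.
Proof.
move=> fg df; have fgx : f x = g x by exact: nbhs_singleton fg.
have fg0 : \forall y \near (0 : V), f (y + x) = g (y + x).
  by move: fg; rewrite (near_shift 0 x) subr0.
have dE : g \o shift x = cst (g x) + 'd f x +o_ 0 id.
  apply/eqaddoP => _/posnumP[e]; have := diff_locally df.
  move=> /eqaddoP/(_ _ (gt0 e)); apply: filterS2 fg0 => y.
  by rewrite !fctE /= /shift fgx => ->.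
have dc : continuous ('d f x) by have /diff_locallyP[] := df.
by apply/diff_locallyP; rewrite (diff_unique dc dE).
Qed.

(** * Smooth functions of real variables *)

Section smooth_real.
Variables (R : realType) (m : nat).
Implicit Types (W : set 'rV[R]_m) (x v : 'rV[R]_m) (g h : 'rV[R]_m -> R^o).

(** Smoothness graded by the order and recursive in the innermost derivative, so that the product
    and quotient rules can be iterated by induction on [k]. In [smooth_on] the head of the list is
    the outermost derivative; [iter_derive_rcons] reconciles the two. *)
Fixpoint class_C k W g : Prop :=
  (forall x, W x -> differentiable g x) /\
  if k is k'.+1 then forall v, class_C k' W (fun x => 'D_v g x : R^o) else True.

Lemma class_C_diff k W g : class_C k W g -> forall x, W x -> differentiable g x.
Proof. by case: k => [|k] []. Qed.

Lemma iter_derive_rcons vs v g :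
  iter_derive (rcons vs v) g = iter_derive vs (fun x => 'D_v g x : R^o).
Proof. by elim: vs => //= w vs ->. Qed.

Lemma smooth_on_class_C W g : smooth_on W g <-> forall k, class_C k W g.
Proof.
split=> [+ k|gC vs].
  elim: k g => [|k IH] g gs; first by split=> // x Wx; exact: (gs [::]).
  split=> [x Wx|v]; first exact: (gs [::]).
  by apply: IH => vs x Wx; rewrite -iter_derive_rcons; exact: gs.
elim/last_ind: vs g gC => [|vs v IH] g gC x Wx.
  by case: (gC 0%N) => + _; exact.
rewrite iter_derive_rcons; apply: IH => // k.
by case: (gC k.+1) => _; exact.
Qed.

Lemma eq_class_C k W g h : open W -> (forall x, W x -> g x = h x) ->
  class_C k W g -> class_C k W h.
Proof.
move=> Wo; have near_gh g' h' (x : 'rV[R]_m) : (forall x, W x -> g' x = h' x) -> W x ->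
    \forall y \near x, g' y = h' y :> R^o.
  move=> gh Wx; have : \forall y \near x, W y by exact: open_nbhs_nbhs.
  by apply: filterS => y; exact: gh.
have dgh g' h' : (forall x, W x -> g' x = h' x) ->
   (forall x, W x -> differentiable (g' : 'rV[R]_m -> R^o) x) ->
   forall x, W x -> differentiable (h' : 'rV[R]_m -> R^o) x.
  by move=> gh dg x Wx; apply: near_eq_differentiable (dg x Wx); exact: near_gh.
elim: k g h => [|k IH] g h gh /= [dg Cg]; split=> //; [exact: (dgh g)|exact: (dgh g)|].
move=> v; apply: IH (Cg v) => x Wx; apply: near_eq_derive; exact: near_gh.
Qed.

Lemma class_CD k W g h : open W -> class_C k W g -> class_C k W h ->
  class_C k W (g + h).
Proof.
move=> Wo; elim: k g h => [|k IH] g h [dg Cg] [dh Ch]; split=> //.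
- by move=> x Wx; apply: differentiableD; [exact: dg|exact: dh].
- by move=> x Wx; apply: differentiableD; [exact: dg|exact: dh].
move=> v; apply: eq_class_C (IH _ _ (Cg v) (Ch v)) => // x Wx.
by rewrite deriveD//; apply: diff_derivable; [exact: dg|exact: dh].
Qed.

Lemma class_CW k W g : class_C k.+1 W g -> class_C k W g.
Proof.
elim: k g => [|k IH] g [dg Cg]; split=> // v.
exact: IH.
Qed.

Lemma class_CM k W g h : open W -> class_C k W g -> class_C k W h ->
  class_C k W (g * h).
Proof.
move=> Wo; elim: k g h => [|k IH] g h Cg Ch; split=> //.
- move=> x Wx; apply: differentiableM; [exact: class_C_diff Cg _ Wx|exact: class_C_diff Ch _ Wx].
- move=> x Wx; apply: differentiableM; [exact: class_C_diff Cg _ Wx|exact: class_C_diff Ch _ Wx].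
move=> v; have [dg Cg'] := Cg; have [dh Ch'] := Ch.
have := class_CD Wo (IH _ _ (class_CW Cg) (Ch' v)) (IH _ _ (class_CW Ch) (Cg' v)).
apply: eq_class_C => // x Wx.
by rewrite deriveM//; apply: diff_derivable; [exact: dg|exact: dh].
Qed.

Lemma class_CN k W g : open W -> class_C k W g -> class_C k W (- g).
Proof.
move=> Wo; elim: k g => [|k IH] g [dg Cg]; split=> //.
- by move=> x Wx; apply: differentiableN; exact: dg.
- by move=> x Wx; apply: differentiableN; exact: dg.
move=> v; apply: eq_class_C (IH _ (Cg v)) => // x Wx.
by rewrite deriveN//; apply: diff_derivable; exact: dg.
Qed.

Lemma class_CV k W g : open W -> (forall x, W x -> g x != 0) ->
  class_C k W g -> class_C k W (fun x => (g x)^-1).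
Proof.
move=> Wo g0; elim: k g g0 => [|k IH] g g0 Cg; split=> //.
- move=> x Wx; apply: (differentiableV (class_C_diff Cg Wx)); exact: g0.
- move=> x Wx; apply: (differentiableV (class_C_diff Cg Wx)); exact: g0.
move=> v; have [dg Cg'] := Cg.
(* The derivative of the inverse contains the inverse again, which is of class [k] by the induction
   hypothesis. *)
have CV := IH _ g0 (class_CW Cg).
have := class_CN Wo (class_CM Wo (class_CM Wo CV CV) (Cg' v)).
apply: eq_class_C => // x Wx.
rewrite deriveV//; [|exact: g0|apply: diff_derivable; exact: dg].
by rewrite /= expr2 invfM scaleNr.
Qed.

End smooth_real.

(** * Symmetry of second derivatives *)

Section schwarz.
Variables (R : realType) (V : normedModType R).
Implicit Types (g : V -> R^o) (x y v w : V).

Lemma is_derive_line g y v (s : R) : differentiable g (s *: v + y) ->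
  is_derive s (1 : R) (fun r : R => g (r *: v + y) : R^o) ('D_v g (s *: v + y)).
Proof.
move=> dg; have /derivableP := @diff_derivable _ _ _ _ _ v dg.
have E : (fun h : R => h^-1 *: (g (h *: v + (s *: v + y)) - g (s *: v + y))) =
  (fun h : R => h^-1 *: ((fun r : R => g (r *: v + y) : R^o) (h *: (1 : R) + s)
     - (fun r : R => g (r *: v + y) : R^o) s)).
  by apply/funext => h /=; rewrite addrA -scalerDl [h%:A]mulr1.
move=> [d1 d2]; split; first by move: d1; rewrite /derivable E.
by rewrite /derive E.
Qed.

(** By the mean value theorem along [v], the second difference is [t] times a difference of two
    values of the first derivative ['D_v g]; differentiability of the latter at [x] expands both
    values to first order. *)
Lemma second_difference g x v w (e : R) : 0 < e ->
  (\forall y \near x, differentiable g y) ->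
  differentiable (fun y => 'D_v g y : R^o) x ->
  \forall t \near 0^'+,
    `|g (t *: v + (t *: w + x)) - g (t *: v + x) - (g (t *: w + x) - g x)
      - t ^+ 2 * 'D_w (fun y => 'D_v g y : R^o) x| <= e * t ^+ 2.
Proof.
move=> e0 dg ddg.
(* Both points of expansion are within [t * N] of [x], the [1] making [N] positive. The factor [2]
   in [e'] accounts for the two remainders. *)
pose N := `|v| + `|w| + 1; have N0 : 0 < N by rewrite ltr_wpDl// addr_ge0.
pose e' := e / (2 * N); have e'0 : 0 < e' by rewrite divr_gt0// mulr_gt0.
have fg0 : \forall h \near (0 : V), differentiable g (h + x).
  by move: dg; rewrite (near_shift 0 x) subr0.
have := diff_locally ddg => /eqaddoP/(_ _ e'0) diffE.
have [d /= d0 bd] := (@nbhs_normP _ V _ _).1 (filterI fg0 diffE).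
have {}bd h : `|h| < d -> differentiable g (h + x) /\
    `|'D_v g (h + x) - 'D_v g x - 'd (fun y => 'D_v g y : R^o) x h| <= e' * `|h|.
  move=> hd; have [|? H] := bd h; first by rewrite /= sub0r normrN.
  by split=> //; move: H; rewrite !fctE /= opprD addrA.
near=> t.
have t0 : 0 < t by near: t; exact: nbhs_right_gt.
have tN : t * N < d.
  by rewrite -ltr_pdivlMr//; near: t; apply: nbhs_right_lt; rewrite divr_gt0.
have small s : 0 <= s <= t -> `|s *: v| <= t * N /\ `|s *: v + t *: w| <= t * N.
  move=> /andP[s0 st].
  have sv : `|s *: v| <= t * `|v|.
    by rewrite normrZ ger0_norm// ler_wpM2r.
  have tw : `|t *: w| = t * `|w| by rewrite normrZ gtr0_norm.
  split.
    by rewrite (le_trans sv)// ler_pM2l// /N -addrA lerDl addr_ge0.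
  rewrite (le_trans (ler_normD _ _))// tw /N !mulrDr mulr1.
  by rewrite (le_trans (lerD sv (lexx _)))// lerDl ltW.
pose F (s : R) : R := g (s *: v + (t *: w + x)) - g (s *: v + x).
pose dF (s : R) : R := 'D_v g (s *: v + (t *: w + x)) - 'D_v g (s *: v + x).
have Fd s : 0 <= s <= t -> is_derive s (1 : R) F (dF s).
  move=> /small[s1 s2]; apply: is_deriveB; apply: is_derive_line.
    by rewrite addrA; apply: (bd _ _).1; exact: le_lt_trans tN.
  by apply: (bd _ _).1; exact: le_lt_trans tN.
have [||s] := @MVT _ F dF 0 t t0.
- by move=> s; rewrite in_itv /= => /andP[s0 st]; apply: Fd; rewrite !ltW.
- apply: derivable_within_continuous => s; rewrite in_itv /= => st.
  by have [] := Fd s st.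
rewrite in_itv /= => /andP[s0 st].
rewrite subr0 {1 2}/F !scale0r !add0r => ->.
have st' : 0 <= s <= t by rewrite !ltW.
have [s1 s2] := small s st'.
have [_ b1] := bd _ (le_lt_trans s1 tN).
have [_ b2] := bd _ (le_lt_trans s2 tN).
rewrite (deriveE _ ddg).
set L := 'd _ x in b1 b2 *.
have LE : t ^+ 2 * L w = (L (s *: v + t *: w) - L (s *: v)) * t.
  by rewrite linearD addrAC subrr add0r linearZ /= expr2 mulrC mulrA [t *: L w]mulrC mulrAC.
rewrite LE -mulrBl normrM (gtr0_norm t0) expr2 mulrA ler_pM2r//.
rewrite /dF.
have -> : 'D_v g (s *: v + (t *: w + x)) - 'D_v g (s *: v + x) -
    (L (s *: v + t *: w) - L (s *: v)) =
  ('D_v g ((s *: v + t *: w) + x) - 'D_v g x - L (s *: v + t *: w)) -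
  ('D_v g (s *: v + x) - 'D_v g x - L (s *: v)).
  rewrite addrA.
  move: ('D_v g _) ('D_v g _) ('D_v g _) (L _) (L _) => a b c p q.
  by ring.
apply: (le_trans (ler_normB _ _)).
apply: (le_trans (lerD b2 b1)).
apply: (@le_trans _ _ (e' * (t * N) + e' * (t * N))).
  by rewrite lerD// ler_pM2l.
rewrite /e' (_ : e / (2 * N) * _ + _ = e * t)//.
by field; rewrite gt_eqF.
Unshelve. all: by end_near. Qed.

(** The second difference is symmetric in [v] and [w], and its quotient by [t ^+ 2] approaches both
    mixed derivatives; each approximation is granted [e / 2]. *)
Theorem derive_comm g x v w :
  (\forall y \near x, differentiable g y) ->
  differentiable (fun y => 'D_v g y : R^o) x ->
  differentiable (fun y => 'D_w g y : R^o) x ->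
  'D_w (fun y => 'D_v g y : R^o) x = 'D_v (fun y => 'D_w g y : R^o) x.
Proof.
move=> dg dv dw; apply/eqP; rewrite -subr_eq0 -normr_le0.
apply/ler_addgt0Pl => e e0; rewrite addr0.
have e2 : 0 < e / 2 by rewrite divr_gt0.
have nA := second_difference w e2 dg dv.
have nB := second_difference v e2 dg dw.
near (0 : R)^'+ => t.
have t0 : 0 < t by near: t; exact: nbhs_right_gt.
have A : `|g (t *: v + (t *: w + x)) - g (t *: v + x) - (g (t *: w + x) - g x)
      - t ^+ 2 * 'D_w (fun y => 'D_v g y : R^o) x| <= e / 2 * t ^+ 2.
  exact: (near nA).
have B : `|g (t *: w + (t *: v + x)) - g (t *: w + x) - (g (t *: v + x) - g x)
      - t ^+ 2 * 'D_v (fun y => 'D_w g y : R^o) x| <= e / 2 * t ^+ 2.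
  exact: (near nB).
rewrite -(@ler_pM2r _ (t ^+ 2)) ?exprn_gt0//.
rewrite -{1}(gtr0_norm (exprn_gt0 2 t0)) -normrM.
rewrite [leRHS](_ : _ = e / 2 * t ^+ 2 + e / 2 * t ^+ 2); last by rewrite -mulrDl -splitr.
apply: (le_trans _ (lerD B A)); apply: (le_trans _ (ler_normB _ _)).
rewrite le_eqVlt; apply/orP; left; apply/eqP; congr (`|_|).
rewrite (addrCA (t *: w)).
move: (g _) (g _) (g _) (g _) ('D_w _ _) ('D_v _ _) => a b c d p q; ring.
Unshelve. all: by end_near. Qed.

End schwarz.

Lemma differentiable_row (R : realType) (V : normedModType R) m
    (f : V -> 'rV[R]_m) (x : V) :
  (forall i, differentiable (fun y => f y 0 i : R^o) x) -> differentiable f x.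
Proof.
move=> df; have -> : f = \sum_(i < m) (fun y => f y 0 i *: delta_mx 0 i).
  apply/funext => y; rewrite fct_sumE [LHS]row_sum_delta.
  by [].
by apply: differentiable_sum => i; exact: differentiableZl.
Qed.

(** * Smooth functions on a manifold *)

Section manifold_calculus.
Variables (R : realType) (m : nat) (M : manifold R m).
Local Notation C := R[i].
Local Notation RV := 'rV[R]_m.
Implicit Types (p q : M) (U V : set M) (f g : M -> C) (h : M -> R).
Implicit Types (X Y : vector_field M).

Definition pull p U : set RV :=
  [set x | chart_cod (chart_at p) x /\ U (cinv (chart_at p) x)].

Lemma chart_atP p : is_chart (chart_at p).
Proof. by have [/(_ p)[]] := manifold_atlas M. Qed.

Lemma chart_domP p : chart_dom (chart_at p) p.
Proof. by have [/(_ p)[]] := manifold_atlas M. Qed.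

Lemma open_chart_dom p : open (chart_dom (chart_at p)).
Proof. by have [] := chart_atP p. Qed.

Lemma cmapK p q : chart_dom (chart_at p) q ->
  cinv (chart_at p) (cmap (chart_at p) q) = q.
Proof. by have [_ _ + _ _] := chart_atP p; exact. Qed.

Lemma cinvK p (x : RV) : chart_cod (chart_at p) x ->
  cmap (chart_at p) (cinv (chart_at p) x) = x.
Proof. by move=> [q pq <-]; rewrite cmapK. Qed.

Lemma chart_dom_cinv p (x : RV) : chart_cod (chart_at p) x ->
  chart_dom (chart_at p) (cinv (chart_at p) x).
Proof. by move=> [q pq <-]; rewrite cmapK. Qed.

Lemma open_pull p U : open U -> open (pull p U).
Proof.
move=> Uo; have [_ co _ _ ic] := chart_atP p.
rewrite openE => x [cx Ux].
apply: filterI; first exact: open_nbhs_nbhs.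
by apply: (ic x cx); exact: open_nbhs_nbhs.
Qed.

Lemma pull_cmap p U q : chart_dom (chart_at p) q -> U q ->
  pull p U (cmap (chart_at p) q).
Proof. by move=> pq Uq; split; [exists q|rewrite cmapK]. Qed.

Definition rsmooth U h :=
  forall p, smooth_on (pull p U) (fun x => h (cinv (chart_at p) x)).

Lemma smooth_funE U f : smooth_fun U f <->
  rsmooth U (fun q => complex.Re (f q)) /\ rsmooth U (fun q => complex.Im (f q)).
Proof. by split=> [H|[H1 H2] p]; [split=> p; have [] := H p|split; [exact: H1|exact: H2]]. Qed.

Lemma rsmooth_class_C U h p k : rsmooth U h ->
  class_C k (pull p U) (fun x => h (cinv (chart_at p) x)).
Proof. by move=> /(_ p)/smooth_on_class_C. Qed.

Lemma eq_rsmooth U h h' : open U -> (forall q, U q -> h q = h' q) ->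
  rsmooth U h -> rsmooth U h'.
Proof.
move=> Uo hh' hs p; apply/smooth_on_class_C => k.
apply: (eq_class_C (g := fun x => h (cinv (chart_at p) x))).
- exact: open_pull.
- by move=> x [_ Ux]; exact: hh'.
- exact: rsmooth_class_C.
Qed.

Lemma rsmoothD U h h' : open U -> rsmooth U h -> rsmooth U h' ->
  rsmooth U (fun q => h q + h' q).
Proof.
move=> Uo hs hs' p; apply/smooth_on_class_C => k.
by apply: class_CD; [exact: open_pull|exact: rsmooth_class_C|
  exact: rsmooth_class_C].
Qed.

Lemma rsmoothM U h h' : open U -> rsmooth U h -> rsmooth U h' ->
  rsmooth U (fun q => h q * h' q).
Proof.
move=> Uo hs hs' p; apply/smooth_on_class_C => k.
by apply: class_CM; [exact: open_pull|exact: rsmooth_class_C|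
  exact: rsmooth_class_C].
Qed.

Lemma rsmoothN U h : open U -> rsmooth U h -> rsmooth U (fun q => - h q).
Proof.
move=> Uo hs p; apply/smooth_on_class_C => k.
by apply: class_CN; [exact: open_pull|exact: rsmooth_class_C].
Qed.

Lemma rsmoothV U h : open U -> (forall q, U q -> h q != 0) ->
  rsmooth U h -> rsmooth U (fun q => (h q)^-1).
Proof.
move=> Uo h0 hs p; apply/smooth_on_class_C => k.
by apply: class_CV; [exact: open_pull|move=> x [_ ?]; exact: h0|
  exact: rsmooth_class_C].
Qed.

Lemma eq_smooth_fun U f g : open U -> (forall q, U q -> f q = g q) ->
  smooth_fun U f -> smooth_fun U g.
Proof.
move=> Uo fg /smooth_funE[f1 f2]; apply/smooth_funE.
by split; [apply: eq_rsmooth f1|apply: eq_rsmooth f2] => // q Uq; rewrite fg.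
Qed.

Lemma sub_smooth_fun U V f : V `<=` U -> smooth_fun U f -> smooth_fun V f.
Proof.
move=> VU fs p; have [f1 f2] := fs p.
by split=> vs x [cx Vx]; [apply: f1|apply: f2]; split=> //; exact: VU.
Qed.

Lemma smooth_fun_local U f :
  (forall q, U q -> exists V, [/\ open V, V q & smooth_fun V f]) ->
  smooth_fun U f.
Proof.
move=> H p; split=> vs x [cx Ux]; have [V [_ Vq fV]] := H _ Ux.
  by have [+ _] := fV p; apply; split.
by have [_ +] := fV p; apply; split.
Qed.

Lemma smooth_fun_cst U (a : C) : smooth_fun U (fun=> a).
Proof. by move=> p; split; exact: smooth_on_cst. Qed.

Lemma smooth_funD U f g : open U -> smooth_fun U f -> smooth_fun U g ->
  smooth_fun U (f + g).
Proof.
move=> Uo /smooth_funE[f1 f2] /smooth_funE[g1 g2]; apply/smooth_funE.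
split; [apply: eq_rsmooth (rsmoothD Uo f1 g1)|
  apply: eq_rsmooth (rsmoothD Uo f2 g2)] => // q _; rewrite fctE.
  by case: (f q) (g q) => [? ?] [? ?].
by case: (f q) (g q) => [? ?] [? ?].
Qed.

Lemma smooth_funM U f g : open U -> smooth_fun U f -> smooth_fun U g ->
  smooth_fun U (fun q => f q * g q).
Proof.
move=> Uo /smooth_funE[f1 f2] /smooth_funE[g1 g2]; apply/smooth_funE; split.
  apply: eq_rsmooth (rsmoothD Uo (rsmoothM Uo f1 g1)
    (rsmoothN Uo (rsmoothM Uo f2 g2))) => // q _.
  by case: (f q) (g q) => [? ?] [? ?].
apply: eq_rsmooth (rsmoothD Uo (rsmoothM Uo f1 g2)
    (rsmoothM Uo f2 g1)) => // q _.
by case: (f q) (g q) => [? ?] [? ?].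
Qed.

Lemma smooth_funZ U (a : C) f : open U -> smooth_fun U f ->
  smooth_fun U (a *: (f : M -> C^o)).
Proof. by move=> Uo; apply: smooth_funM => //; exact: smooth_fun_cst. Qed.

Lemma smooth_funN U f : open U -> smooth_fun U f -> smooth_fun U (- f).
Proof.
move=> Uo fs; rewrite -[- f]/(- (f : M -> C^o)) -scaleN1r.
exact: smooth_funZ.
Qed.

Lemma smooth_fun_sum U (I : Type) (r : seq I) (P : pred I) (F : I -> M -> C) :
  open U -> (forall i, P i -> smooth_fun U (F i)) ->
  smooth_fun U (fun q => \sum_(i <- r | P i) F i q).
Proof.
move=> Uo Fs; rewrite -fct_sumE; elim/big_ind: _ => //.
  exact: smooth_fun_cst.
by move=> f g; exact: smooth_funD.
Qed.

Lemma smooth_fun_prod U (I : Type) (r : seq I) (P : pred I) (F : I -> M -> C) :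
  open U -> (forall i, P i -> smooth_fun U (F i)) ->
  smooth_fun U (fun q => \prod_(i <- r | P i) F i q).
Proof.
move=> Uo Fs; elim: r => [|i r IH].
  apply: eq_smooth_fun (smooth_fun_cst U 1) => // q _.
  by rewrite big_nil.
have [Pi|Pi] := boolP (P i).
  apply: eq_smooth_fun (smooth_funM Uo (Fs i Pi) IH) => // q _.
  by rewrite big_cons Pi.
by apply: eq_smooth_fun IH => // q _; rewrite big_cons (negbTE Pi).
Qed.

Lemma smooth_fun_det U k (A : M -> 'M[C]_k) : open U ->
  (forall i j, smooth_fun U (fun q => A q i j)) ->
  smooth_fun U (fun q => \det (A q)).
Proof.
move=> Uo As; apply: smooth_fun_sum => // s _.
apply: smooth_funM => //; first exact: smooth_fun_cst.
by apply: smooth_fun_prod.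
Qed.

Lemma smooth_fun_conj U f : open U -> smooth_fun U f ->
  smooth_fun U (fun q => conjc (f q)).
Proof.
move=> Uo /smooth_funE[f1 f2]; apply/smooth_funE; split.
  by apply: eq_rsmooth f1 => // q _; case: (f q).
by apply: eq_rsmooth (rsmoothN Uo f2) => // q _; case: (f q).
Qed.

Lemma smooth_funV U f : open U -> (forall q, U q -> f q != 0) ->
  smooth_fun U f -> smooth_fun U (fun q => (f q)^-1).
Proof.
move=> Uo f0 fs.
(* The inverse is the conjugate divided by the squared modulus [N], which leaves a real function to
   invert. *)
pose N q := complex.Re (f q) * complex.Re (f q) + complex.Im (f q) * complex.Im (f q).
have Ns : rsmooth U N.
  by have /smooth_funE[f1 f2] := fs; apply: rsmoothD => //; exact: rsmoothM.
have NV : smooth_fun U (fun q => Complex (N q)^-1 0).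
  apply/smooth_funE; split; last by move=> p; exact: smooth_on_cst.
  apply: rsmoothV => // q Uq; have := f0 _ Uq; rewrite /N.
  case: (f q) => a b; rewrite eq_complex /= -!expr2.
  by rewrite paddr_eq0 ?sqr_ge0// !sqrf_eq0.
apply: eq_smooth_fun (smooth_funM Uo (smooth_fun_conj Uo fs) NV) => // q Uq.
rewrite /N; case: (f q) => a b /=.
apply/eqP; rewrite eq_complex /= !mulr0 subr0 add0r -!expr2 !mulNr eqxx/=.
exact: eqxx.

Qed.

(** Read in another chart, a coordinate function is a component of a transition map. *)
Lemma smooth_coord p i : smooth_fun (chart_dom (chart_at p)) (Defs.coord p i).
Proof.
move=> q; split; last by exact: smooth_on_cst.
have [_ /(_ q p)/(_ i) H] := manifold_atlas M.
move=> vs x [[r qr <-{x}]]; rewrite cmapK// => pr.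
by apply: H; exists r.
Qed.

End manifold_calculus.

(** * Derivatives of complex-valued functions *)

Section cderive.
Variables (R : realType) (V : normedModType R).
Local Notation C := R[i].
Implicit Types (g h : V -> C) (x v : V).

Definition cdifferentiable g x :=
  differentiable (fun y => complex.Re (g y) : R^o) x /\
  differentiable (fun y => complex.Im (g y) : R^o) x.

Lemma near_eq_cdifferentiable g h x : (\near x, g x = h x) ->
  cdifferentiable g x -> cdifferentiable h x.
Proof.
move=> gh [g1 g2]; split.
  by apply: near_eq_differentiable g1; apply: filterS gh => y /= ->.
by apply: near_eq_differentiable g2; apply: filterS gh => y /= ->.
Qed.

Lemma cdifferentiableD g h x : cdifferentiable g x -> cdifferentiable h x ->
  cdifferentiable (fun y => g y + h y) x.
Proof.
move=> [g1 g2] [h1 h2]; split.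
  apply: near_eq_differentiable (differentiableD g1 h1); near=> y.
  by rewrite fctE; case: (g y) (h y) => [? ?] [? ?].
apply: near_eq_differentiable (differentiableD g2 h2); near=> y.
by rewrite fctE; case: (g y) (h y) => [? ?] [? ?].
Unshelve. all: by end_near. Qed.

Lemma cdifferentiableM g h x : cdifferentiable g x -> cdifferentiable h x ->
  cdifferentiable (fun y => g y * h y) x.
Proof.
move=> [g1 g2] [h1 h2]; split.
  apply: near_eq_differentiable (differentiableB (differentiableM g1 h1)
    (differentiableM g2 h2)); near=> y.
  by rewrite /= !fctE; case: (g y) (h y) => [? ?] [? ?]. 
apply: near_eq_differentiable (differentiableD (differentiableM g1 h2)
    (differentiableM g2 h1)); near=> y.
by rewrite /= !fctE /=; case: (g y) (h y) => [? ?] [? ?].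
Unshelve. all: by end_near. Qed.

End cderive.

Section cderive_row.
Variables (R : realType) (m : nat).
Local Notation C := R[i].
Implicit Types (g h : 'rV[R]_m -> C) (x v : 'rV[R]_m).

Lemma near_eq_cderive g h x v : (\near x, g x = h x) ->
  cderive g v x = cderive h v x.
Proof.
move=> gh; rewrite /cderive; congr Complex.
  by apply: near_eq_derive; apply: filterS gh => y /= ->.
by apply: near_eq_derive; apply: filterS gh => y /= ->.
Qed.

Lemma cderive_cst (a : C) v x : cderive (fun=> a) v x = 0.
Proof. by rewrite /cderive !derive_cst. Qed.

Lemma cderiveD g h x v : cdifferentiable g x -> cdifferentiable h x ->
  cderive (fun y => g y + h y) v x = cderive g v x + cderive h v x.
Proof.
move=> [g1 g2] [h1 h2]; rewrite /cderive.
have -> : (fun y => complex.Re (g y + h y) : R^o) =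
    (fun y => complex.Re (g y) : R^o) + (fun y => complex.Re (h y) : R^o).
  by apply/funext => y; rewrite fctE; case: (g y) (h y) => [? ?] [? ?].
have -> : (fun y => complex.Im (g y + h y) : R^o) =
    (fun y => complex.Im (g y) : R^o) + (fun y => complex.Im (h y) : R^o).
  by apply/funext => y; rewrite fctE; case: (g y) (h y) => [? ?] [? ?].
by rewrite !deriveD//; exact: diff_derivable.
Qed.

Lemma cderiveM g h x v : cdifferentiable g x -> cdifferentiable h x ->
  cderive (fun y => g y * h y) v x = cderive g v x * h x + g x * cderive h v x.
Proof.
move=> [g1 g2] [h1 h2]; rewrite /cderive.
have -> : (fun y => complex.Re (g y * h y) : R^o) =
    (fun y => complex.Re (g y) : R^o) * (fun y => complex.Re (h y) : R^o) -
    (fun y => complex.Im (g y) : R^o) * (fun y => complex.Im (h y) : R^o).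
  by apply/funext => y; rewrite !fctE; case: (g y) (h y) => [? ?] [? ?].
have -> : (fun y => complex.Im (g y * h y) : R^o) =
    (fun y => complex.Re (g y) : R^o) * (fun y => complex.Im (h y) : R^o) +
    (fun y => complex.Im (g y) : R^o) * (fun y => complex.Re (h y) : R^o).
  by apply/funext => y; rewrite !fctE; case: (g y) (h y) => [? ?] [? ?].
rewrite deriveB; [|apply: derivableM; exact: diff_derivable|
  apply: derivableM; exact: diff_derivable].
rewrite deriveD; [|apply: derivableM; exact: diff_derivable|
  apply: derivableM; exact: diff_derivable].
rewrite !deriveM; do ?exact: diff_derivable.
case: (g x) (h x) => [a b] [c d] /=.
apply/eqP; rewrite eq_complex /= /GRing.scale /=; apply/andP.
by split; apply/eqP; ring.
Qed.

Lemma cderive_conj g v x : cdifferentiable g x ->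
  cderive (fun y => conjc (g y)) v x = conjc (cderive g v x).
Proof.
move=> [g1 g2]; rewrite /cderive /=.
have -> : (fun y => complex.Re (conjc (g y)) : R^o) = fun y => complex.Re (g y).
  by apply/funext => y; case: (g y).
have -> : (fun y => complex.Im (conjc (g y)) : R^o) =
    - (fun y => complex.Im (g y) : R^o).
  by apply/funext => y; rewrite fctE; case: (g y).
by rewrite deriveN//; exact: diff_derivable.
Qed.

Lemma cderive_comp (k : nat) g (T : 'rV[R]_k -> 'rV[R]_m) (x v : 'rV[R]_k) :
  cdifferentiable g (T x) -> (forall i, differentiable (fun y => T y 0 i : R^o) x) ->
  cderive (g \o T) v x =
  \sum_(i < m) Complex ('D_v (fun y => T y 0 i : R^o) x) 0 *
    cderive g (delta_mx 0 i) (T x).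
Proof.
move=> [g1 g2] dTi; have dT := differentiable_row dTi.
have D (h : 'rV[R]_m -> R^o) : differentiable h (T x) ->
    'D_v (h \o T) x = \sum_(i < m) 'D_v (fun y => T y 0 i : R^o) x *
      'D_(delta_mx 0 i) h (T x).
  move=> dh; rewrite deriveE; last exact: differentiable_comp.
  rewrite diff_comp//= -(deriveE v dT) derive_mx; last exact: diff_derivable.
  rewrite [X in 'd _ _ X]row_sum_delta linear_sum; apply: eq_bigr => i _.
  by rewrite mxE linearZ /= -deriveE.
rewrite {1}/cderive (D (fun y => complex.Re (g y))) // (D (fun y => complex.Im (g y)))//.
have CE i : Complex ('D_v (fun y => T y 0 i : R^o) x) 0 *
    cderive g (delta_mx 0 i) (T x) = Complex
   ('D_v (fun y => T y 0 i : R^o) x *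
     'D_(delta_mx 0 i) (fun y => complex.Re (g y) : R^o) (T x))
   ('D_v (fun y => T y 0 i : R^o) x *
     'D_(delta_mx 0 i) (fun y => complex.Im (g y) : R^o) (T x)).
  by apply/eqP; rewrite eq_complex /= !mul0r subr0 addr0 !eqxx.
rewrite (eq_bigr _ (fun i _ => CE i)).
by elim/big_ind3: _ => // a b c a' b' c' <- <-.
Qed.

Lemma cderive_comm g v w x :
  (\forall y \near x, cdifferentiable g y) ->
  cdifferentiable (cderive g v) x -> cdifferentiable (cderive g w) x ->
  cderive (cderive g v) w x = cderive (cderive g w) v x.
Proof.
move=> dg [v1 v2] [w1 w2].
have dgR : \forall y \near x, differentiable (fun z => complex.Re (g z) : R^o) y.
  by apply: filterS dg => y [].
have dgI : \forall y \near x, differentiable (fun z => complex.Im (g z) : R^o) y.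
  by apply: filterS dg => y [].
have ER := derive_comm dgR v1 w1; have EI := derive_comm dgI v2 w2.
exact: (congr2 (@Complex R) ER EI).
Qed.

End cderive_row.

(** * Vector fields and their brackets *)

Section vector_fields.
Variables (R : realType) (m : nat) (M : manifold R m).
Local Notation C := R[i].
Local Notation RV := 'rV[R]_m.
Implicit Types (p q : M) (U V : set M) (f g : M -> C).
Implicit Types (X Y : vector_field M).

(** The chart stays that of [p] while [q] moves, whereas [vact] changes chart with the point; only
    the former can be differentiated again in coordinates. *)
Definition pd p i f q : C :=
  cderive (f \o cinv (chart_at p)) (delta_mx 0 i) (cmap (chart_at p) q).

Lemma smooth_cdifferentiable U p q f : smooth_fun U f ->
  chart_dom (chart_at p) q -> U q ->
  cdifferentiable (f \o cinv (chart_at p)) (cmap (chart_at p) q).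
Proof.
move=> fs pq Uq; have Wq := pull_cmap pq Uq.
by have [f1 f2] := fs p; split; [exact: (f1 [::])|exact: (f2 [::])].
Qed.

Lemma near_pull U p q : open U -> chart_dom (chart_at p) q -> U q ->
  \forall x \near cmap (chart_at p) q, pull p U x.
Proof.
move=> Uo pq Uq; apply: open_nbhs_nbhs; split; first exact: open_pull.
exact: pull_cmap.
Qed.

Lemma near_eq_vact U X f g p : open U -> U p -> (forall q, U q -> f q = g q) ->
  vact X f p = vact X g p.
Proof.
move=> Uo Up fg; apply: eq_bigr => i _; congr (_ * _).
apply: near_eq_cderive; apply: filterS (near_pull Uo (chart_domP p) Up) => x.
by move=> [_ Ux] /=; rewrite fg.
Qed.

Lemma eq_vact_at X Y f p : X p = Y p -> vact X f p = vact Y f p.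
Proof. by move=> XY; rewrite /vact XY. Qed.

Lemma vactDl X Y f : vact (X + Y) f = vact X f + vact Y f.
Proof.
apply/funext => p; rewrite -[RHS]/(vact X f p + vact Y f p) /vact -big_split.
by apply: eq_bigr => i _ /=; rewrite -mulrDl; congr (_ * _); rewrite mxE.
Qed.

Lemma vact_scalel (a : M -> C) X f p : vact (fscale a X) f p = a p * vact X f p.
Proof.
rewrite /vact mulr_sumr; apply: eq_bigr => i _.
by rewrite /fscale mxE mulrA.
Qed.

Lemma vact0l f : vact (0 : vector_field M) f = 0.
Proof. by apply/funext => p; rewrite /vact big1// => i _; rewrite mxE mul0r. Qed.

Lemma vactNl X f : vact (- X) f = - vact X f.
Proof.
by apply/eqP; rewrite -subr_eq0 opprK -vactDl addNr vact0l.
Qed.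

Lemma vact_suml (I : Type) (r : seq I) (P : pred I) (F : I -> vector_field M) f :
  vact (\sum_(i <- r | P i) F i) f = \sum_(i <- r | P i) vact (F i) f.
Proof.
by apply: (big_morph (fun X => vact X f)) => [X Y|]; rewrite ?vactDl ?vact0l.
Qed.

Lemma vact_cst X (a : C) : vact X (fun=> a) = 0.
Proof.
apply/funext => p; rewrite /vact big1// => i _.
by rewrite [X in _ * X]cderive_cst mulr0.
Qed.

Definition cdiff_at f p :=
  cdifferentiable (f \o cinv (chart_at p)) (cmap (chart_at p) p).

Lemma smooth_cdiff_at U f p : smooth_fun U f -> U p -> cdiff_at f p.
Proof. by move=> fs Up; exact: (smooth_cdifferentiable fs (chart_domP p) Up). Qed.

Lemma vactD X f g p : cdiff_at f p -> cdiff_at g p ->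
  vact X (f + g) p = vact X f p + vact X g p.
Proof.
move=> df dg; rewrite /vact -big_split; apply: eq_bigr => i _ /=.
by rewrite -mulrDr; congr (_ * _); exact: cderiveD.
Qed.

Lemma vactM X f g p : cdiff_at f p -> cdiff_at g p ->
  vact X (fun q => f q * g q) p = vact X f p * g p + f p * vact X g p.
Proof.
move=> df dg; rewrite /vact mulr_suml mulr_sumr -big_split; apply: eq_bigr => i _ /=.
rewrite [cderive _ _ _](cderiveM _ df dg) /= mulrDr mulrA; congr (_ + _).
  by rewrite cmapK//; exact: chart_domP.
rewrite cmapK; last exact: chart_domP.
by rewrite mulrCA.
Qed.

Lemma cdiff_atD f g p : cdiff_at f p -> cdiff_at g p -> cdiff_at (f + g) p.
Proof. exact: cdifferentiableD. Qed.

Lemma cdiff_atM f g p : cdiff_at f p -> cdiff_at g p ->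
  cdiff_at (fun q => f q * g q) p.
Proof. exact: cdifferentiableM. Qed.

Lemma vact_sum X (I : finType) (F : I -> M -> C) p :
  (forall i, cdiff_at (F i) p) ->
  vact X (fun q => \sum_i F i q) p = \sum_i vact X (F i) p.
Proof.
move=> dF; rewrite -fct_sumE.
have [_ //] : cdiff_at (\sum_i F i) p /\ vact X (\sum_i F i) p = \sum_i vact X (F i) p.
elim/big_rec2: _ => [|i a f _ [df <-]].
  split; first by split; exact: differentiable_cst.
  by rewrite [vact _ _](vact_cst X 0).
by split; [exact: cdiff_atD|exact: vactD].
Qed.

Lemma pd_coord p i j : pd p j (Defs.coord p i) p = (i == j)%:R.
Proof.
rewrite /pd; set x := cmap _ p.
have -> : cderive (Defs.coord p i \o cinv (chart_at p)) (delta_mx 0 j) x =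
    cderive (fun y : RV => Complex (y 0 i) 0) (delta_mx 0 j) x.
  apply: near_eq_cderive.
  apply: filterS (near_pull openT (chart_domP p) (I : setT p)) => y [cy _].
  by rewrite /= /Defs.coord cinvK.
rewrite /cderive /= derive_cst.
have di : derivable (id : RV -> RV) x (delta_mx 0 j) by exact: derivable_id.
have := derive_mx di.
move=> /matrixP/(_ 0 i); rewrite derive_id !mxE /= => <-.
by case: (i == j).
Qed.

Lemma vact_coord X p i : vact X (Defs.coord p i) p = X p 0 i.
Proof.
rewrite /vact (bigD1 i)//= big1 ?addr0 => [|j ji].
  by rewrite [cderive _ _ _]pd_coord eqxx mulr1.
by rewrite [cderive _ _ _]pd_coord eq_sym (negbTE ji) mulr0.
Qed.

(** The chain rule for the transition map from the chart at [q] to the one at [p] replaces the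
    moving chart by a fixed one. *)
Lemma vact_chart X U f p q : open U -> smooth_fun U f ->
  chart_dom (chart_at p) q -> U q ->
  vact X f q = \sum_i vact X (Defs.coord p i) q * pd p i f q.
Proof.
move=> Uo fs pq Uq.
under [RHS]eq_bigr do rewrite /vact mulr_suml.
rewrite exchange_big /=; apply: eq_bigr => j _.
under [RHS]eq_bigr do rewrite -mulrA.
rewrite -mulr_sumr; congr (_ * _).
pose x := cmap (chart_at q) q; pose T := transition (chart_at q) (chart_at p).
have nq := near_pull (open_chart_dom p) (chart_domP q) pq.
have Tx : T x = cmap (chart_at p) q by rewrite /T /transition /= cmapK//; exact: chart_domP.
transitivity (cderive ((f \o cinv (chart_at p)) \o T) (delta_mx 0 j) x).
  apply: near_eq_cderive; apply: filterS nq => y [cy py] /=.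
  by rewrite /T /transition /= cmapK.
rewrite cderive_comp.
- rewrite Tx; apply: eq_bigr => i _; congr (_ * _).
  rewrite /cderive /=.
  by rewrite derive_cst.
- by rewrite Tx; exact: (smooth_cdifferentiable fs).
- move=> i; have [+ _] := smooth_cdifferentiable (smooth_coord p i) (chart_domP q) pq.
  exact.
Qed.

(** By definition the bracket is known only through the coordinates at [p]. For general [f], the
    expansion in that chart has a first-order part given by the coordinates and a second-order part
    that cancels by symmetry of second derivatives. *)
Lemma vact_lie U X Y f p : open U -> U p -> smooth_field U X ->
  smooth_field U Y -> smooth_fun U f ->
  vact (lie_bracket X Y) f p = vact X (vact Y f) p - vact Y (vact X f) p.
Proof.
move=> Uo Up Xs Ys fs.
pose D := U `&` chart_dom (chart_at p).
have Do : open D by apply: openI => //; exact: open_chart_dom.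
have Dp : D p by split=> //; exact: chart_domP.
have cs Z i : smooth_field U Z -> smooth_fun D (vact Z (Defs.coord p i)).
  move=> Zs; apply: Zs => //; first by move=> q [].
  by apply: sub_smooth_fun (@smooth_coord _ _ _ p i) => q [].
pose x := cmap (chart_at p) p.
have npd i : \forall y \near x,
    cderive (f \o cinv (chart_at p)) (delta_mx 0 i) y = pd p i f (cinv (chart_at p) y).
  apply: filterS (near_pull Do (chart_domP p) Dp) => y [cy _].
  by rewrite /pd cinvK.
have dcd i : cdifferentiable (cderive (f \o cinv (chart_at p)) (delta_mx 0 i)) x.
  have Wq := pull_cmap (chart_domP p) Up.
  by have [f1 f2] := fs p; split; [exact: (f1 [:: delta_mx 0 i])|exact: (f2 [:: delta_mx 0 i])].
have dpd i : cdiff_at (pd p i f) p.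
  by apply: near_eq_cdifferentiable (dcd i); exact: npd.
have dco Z i : smooth_field U Z -> cdiff_at (vact Z (Defs.coord p i)) p.
  by move=> Zs; apply: smooth_cdiff_at (cs _ _ Zs) Dp.
(* The first sum carries the derivatives of the components of [Z2]; the second involves only the
   values of both fields at [p] and the second derivatives of [f]. *)
have act2 Z1 Z2 : smooth_field U Z2 ->
    vact Z1 (vact Z2 f) p = \sum_i vact Z1 (vact Z2 (Defs.coord p i)) p * pd p i f p
      + \sum_i \sum_j Z2 p 0 i * (Z1 p 0 j *
        cderive (cderive (f \o cinv (chart_at p)) (delta_mx 0 i)) (delta_mx 0 j) x).
  move=> Z2s.
  transitivity (vact Z1 (fun q => \sum_i vact Z2 (Defs.coord p i) q * pd p i f q) p).
    apply: (near_eq_vact _ Do Dp) => q [Uq pq].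
    exact: (vact_chart _ Uo).
  rewrite vact_sum => [|i]; last by apply: cdiff_atM => //; exact: dco.
  rewrite -big_split; apply: eq_bigr => i _ /=.
  rewrite vactM//; last exact: dco.
  congr (_ + _); rewrite vact_coord /vact mulr_sumr; apply: eq_bigr => j _.
  have E : cderive (cderive (f \o cinv (chart_at p)) (delta_mx 0 i)) (delta_mx 0 j) x =
      cderive (pd p i f \o cinv (chart_at p)) (delta_mx 0 j) x.
    exact: near_eq_cderive (npd i).
  by rewrite E.
have df : \forall y \near x, cdifferentiable (f \o cinv (chart_at p)) y.
  apply: filterS (near_pull Uo (chart_domP p) Up) => y [cy Uy].
  have := smooth_cdifferentiable fs (chart_dom_cinv cy) Uy.
  by rewrite cinvK.
rewrite !act2//.
set S1 := (X in _ = _ + X - _); set S2 := (X in _ = _ - (_ + X)).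
have -> : S1 = S2.
  rewrite /S1 /S2 exchange_big; apply: eq_bigr => i _; apply: eq_bigr => j _ /=.
  by rewrite mulrCA (cderive_comm df (dcd _) (dcd _)).
rewrite opprD addrACA subrr addr0 -sumrB; apply: eq_bigr => i _.
by rewrite mxE mulrBl.
Qed.

Lemma smooth_lie U X Y : open U -> smooth_field U X -> smooth_field U Y ->
  smooth_field U (lie_bracket X Y).
Proof.
move=> Uo Xs Ys V f Vo VU fs.
have sub Z : smooth_field U Z -> smooth_field V Z.
  by move=> Zs W g Wo WV; apply: Zs => //; exact: subset_trans VU.
have XYf : smooth_fun V (vact X (vact Y f)) by apply: Xs => //; exact: Ys.
have YXf : smooth_fun V (vact Y (vact X f)) by apply: Ys => //; exact: Xs.
apply: eq_smooth_fun (smooth_funD Vo XYf (smooth_funN Vo YXf)) => // q Vq.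
by rewrite (vact_lie Vo Vq (sub _ Xs) (sub _ Ys) fs).
Qed.

Lemma lieC X Y : lie_bracket X Y = - lie_bracket Y X.
Proof.
by apply/funext => p; rewrite fctE; apply/rowP => i; rewrite !mxE opprB.
Qed.

Lemma lieDl X1 X2 Y : smooth_field setT X1 -> smooth_field setT X2 ->
  lie_bracket (X1 + X2) Y = lie_bracket X1 Y + lie_bracket X2 Y.
Proof.
move=> X1s X2s; apply/funext => p; rewrite fctE; apply/rowP => i.
have dc Z : smooth_field setT Z -> cdiff_at (vact Z (Defs.coord p i)) p.
  move=> Zs; apply: (@smooth_cdiff_at (chart_dom (chart_at p))).
    by apply: Zs => //; [exact: open_chart_dom|exact: smooth_coord].
  exact: chart_domP.
rewrite !mxE vactDl fctE vactDl vactD; [|exact: dc|exact: dc].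
by rewrite addrACA opprD.
Qed.

Lemma lieDr X Y1 Y2 : smooth_field setT Y1 -> smooth_field setT Y2 ->
  lie_bracket X (Y1 + Y2) = lie_bracket X Y1 + lie_bracket X Y2.
Proof.
by move=> Y1s Y2s; rewrite lieC lieDl// opprD -!lieC.
Qed.

Lemma vact_conj X f p : cdiff_at f p ->
  vact (conj_field X) (fun q => conjc (f q)) p = conjc (vact X f p).
Proof.
move=> df; rewrite /vact rmorph_sum; apply: eq_bigr => i _ /=.
rewrite mxE rmorphM; congr (_ * _).
exact: (cderive_conj _ df).
Qed.

Lemma conjc_conjc (a : C) : conjc (conjc a) = a.
Proof. by case: a => a b; rewrite /= opprK. Qed.

Lemma conj_fieldK X : conj_field (conj_field X) = X.
Proof.
by apply/funext => p; apply/rowP => i; rewrite !mxE conjc_conjc.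
Qed.

Lemma smooth_field_conj U X : smooth_field U X -> smooth_field U (conj_field X).
Proof.
move=> Xs V f Vo VU fs.
have cfs := smooth_fun_conj Vo fs.
apply: eq_smooth_fun (smooth_fun_conj Vo (Xs _ _ Vo VU cfs)) => // q Vq.
rewrite -vact_conj; last exact: smooth_cdiff_at cfs Vq.
by congr vact; apply/funext => y; rewrite conjc_conjc.
Qed.

(** The coordinate functions are real, so conjugating both fields conjugates their iterated actions
    on them. *)
Lemma lie_conj X Y : smooth_field setT X -> smooth_field setT Y ->
  lie_bracket (conj_field X) (conj_field Y) = conj_field (lie_bracket X Y).
Proof.
move=> Xs Ys; apply/funext => p; apply/rowP => i.
have cc : Defs.coord p i = (fun q => conjc (Defs.coord p i q)).
  by apply/funext => q; rewrite /Defs.coord /= oppr0.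
have cs := @smooth_coord _ _ _ p i.
have po := open_chart_dom p; have pp := chart_domP p.
have A Z1 Z2 : smooth_field setT Z1 -> smooth_field setT Z2 ->
    vact (conj_field Z1) (vact (conj_field Z2) (Defs.coord p i)) p =
    conjc (vact Z1 (vact Z2 (Defs.coord p i)) p).
  move=> Z1s Z2s; rewrite -vact_conj; last first.
    by apply: smooth_cdiff_at pp; apply: Z2s.
  apply: (near_eq_vact _ po pp) => q pq.
  by rewrite {1}cc vact_conj//; exact: smooth_cdiff_at cs pq.
by rewrite !mxE !A// rmorphB.
Qed.

Lemma smooth_fieldD U X Y : smooth_field U X -> smooth_field U Y ->
  smooth_field U (X + Y).
Proof.
by move=> Xs Ys V f Vo VU fs; rewrite vactDl; apply: smooth_funD => //; [exact: Xs|exact: Ys].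
Qed.

Lemma smooth_fieldN U X : smooth_field U X -> smooth_field U (- X).
Proof.
by move=> Xs V f Vo VU fs; rewrite vactNl; apply: smooth_funN => //; exact: Xs.
Qed.

Lemma smooth_fieldZ U (a : M -> C) X : open U -> smooth_fun U a -> smooth_field U X ->
  smooth_field U (fscale a X).
Proof.
move=> Uo asm Xs V f Vo VU fs.
apply: eq_smooth_fun (smooth_funM Vo (sub_smooth_fun VU asm) (Xs _ _ Vo VU fs)) => //.
by move=> q Vq; rewrite vact_scalel.
Qed.

End vector_fields.

(** * The decomposition of the tangent bundle *)

Section frames.
Variables (R : realType) (m : nat) (M : manifold R m).
Local Notation C := R[i].
Implicit Types (p q : M) (U V : set M) (f g : M -> C).
Implicit Types (X Y : vector_field M).

(** The action at [q] depends only on the value of the field at [q], so the coefficients may be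
    taken constant. *)
Lemma vact_lincomb (I : finType) (G : I -> vector_field M) (c : I -> C) X f q :
  X q = \sum_i c i *: G i q -> vact X f q = \sum_i c i * vact (G i) f q.
Proof.
move=> Xq.
have -> : vact X f q = vact (\sum_i fscale (fun=> c i) (G i)) f q.
  by apply: eq_vact_at; rewrite Xq fct_sumE.
rewrite vact_suml fct_sumE; apply: eq_bigr => i _.
by rewrite vact_scalel.
Qed.

Lemma open_neq0 U (h : M -> R) : open U -> rsmooth U h ->
  open [set q | U q /\ h q != 0].
Proof.
move=> Uo hs; rewrite openE => q [Uq hq].
have qq := chart_domP q.
have [_ _ _ cc _] := chart_atP q.
have dh : differentiable (fun x => h (cinv (chart_at q) x) : R^o) (cmap (chart_at q) q).
  exact: (hs q [::] _ (pull_cmap qq Uq)).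
have hc := differentiable_continuous dh.
have n0 : \forall x \near cmap (chart_at q) q, h (cinv (chart_at q) x) != 0.
  apply: (hc [set y | y != 0]); rewrite /= cmapK//.
  apply: open_nbhs_nbhs; split=> //; exact: open_neq.
have := cc q qq _ n0.
have dq : \forall q' \near q, chart_dom (chart_at q) q'.
  by apply: open_nbhs_nbhs; split=> //; exact: open_chart_dom.
have Uq' : \forall q' \near q, U q' by exact: open_nbhs_nbhs.
move=> nh; apply: filterS3 dq Uq' nh => q' dq' uq' /=.
by rewrite cmapK.
Qed.

Lemma open_cneq0 U f : open U -> smooth_fun U f ->
  open [set q | U q /\ f q != 0].
Proof.
move=> Uo /smooth_funE[f1 f2].
have := open_neq0 Uo (rsmoothD Uo (rsmoothM Uo f1 f1) (rsmoothM Uo f2 f2)).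
congr open; apply/seteqP; split=> q [Uq] fq; split=> //; move: fq.
all: case: (f q) => a b; rewrite eq_complex /= -!expr2.
all: by rewrite paddr_eq0 ?sqr_ge0// !sqrf_eq0.
Qed.

(* The components of the frame in one fixed chart form a smooth invertible
   matrix, so Cramer's rule gives smooth coefficients. *)
Lemma frame_coefficients U (G : 'I_m -> vector_field M) X p : open U -> U p ->
  (forall i, smooth_field U (G i)) ->
  (forall q, U q -> row_free (\matrix_i G i q)) -> smooth_field U X ->
  exists V, [/\ open V, V p, V `<=` U & exists g : 'I_m -> M -> C,
    (forall i, smooth_fun V (g i)) /\
    forall q, V q -> X q = \sum_i g i q *: G i q].
Proof.
move=> Uo Up Gs Gfree Xs.
pose D := U `&` chart_dom (chart_at p).
have Do : open D by apply: openI => //; exact: open_chart_dom.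
have Dp : D p by split=> //; exact: chart_domP.
pose A q : 'M[C]_m := \matrix_(i, j) vact (G i) (Defs.coord p j) q.
have cs Z i : smooth_field U Z -> smooth_fun D (vact Z (Defs.coord p i)).
  move=> Zs; apply: Zs => //; first by move=> q [].
  by apply: sub_smooth_fun (@smooth_coord _ _ _ p i) => q [].
have As i j : smooth_fun D (fun q => A q i j).
  by apply: eq_smooth_fun (cs _ j (Gs i)) => // q _; rewrite mxE.
have dAs := smooth_fun_det Do As.
have dVo := open_cneq0 Do dAs.
set V := [set q | D q /\ \det (A q) != 0] in dVo.
have VD : V `<=` D by move=> q [].
have Vp : V p.
  split=> //; have -> : A p = \matrix_i G i p.
    by apply/matrixP => i j; rewrite !mxE vact_coord.
  by rewrite -unitfE -unitmxE -row_free_unit; exact: Gfree.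
exists V; split=> //; first by move=> q [[]].
exists (fun i q => \sum_j vact X (Defs.coord p j) q * ((\det (A q))^-1 * cofactor (A q) i j)).
split=> [i|q [[Uq pq] dA]].
  apply: smooth_fun_sum => // j _; apply: smooth_funM => //.
    by apply: sub_smooth_fun VD _; exact: cs.
  apply: smooth_funM => //.
    by apply: smooth_funV => //; [move=> q []|exact: sub_smooth_fun VD _].
  apply: smooth_funM => //; first exact: smooth_fun_cst.
  apply: smooth_fun_det => // k l; apply: sub_smooth_fun VD _.
  apply: eq_smooth_fun (As (lift i k) (lift j l)) => // x _.
  by rewrite !mxE.
have Au : A q \in unitmx by rewrite unitmxE unitfE.
have Gu : \matrix_i G i q \in unitmx by rewrite -row_free_unit; exact: Gfree.
have [c cG] : exists c : 'rV[C]_m, X q = c *m \matrix_i G i q.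
  by exists (X q *m invmx (\matrix_i G i q)); rewrite mulmxKV.
have XE : X q = \sum_i c 0 i *: G i q.
  rewrite cG mulmx_sum_row; apply: eq_bigr => i _.
  by rewrite rowK.
have cA : c *m A q = \row_j vact X (Defs.coord p j) q.
  apply/rowP => j; rewrite mxE [RHS]mxE (vact_lincomb _ XE); apply: eq_bigr => i _.
  by rewrite [A q i j]mxE.
have cE : c = (\row_j vact X (Defs.coord p j) q) *m invmx (A q).
  by rewrite -cA mulmxK.
rewrite {1}XE; apply: eq_bigr => i _; congr (_ *: _).
rewrite cE mxE; apply: eq_bigr => j _; rewrite mxE /invmx Au.
by rewrite !mxE.
Qed.

End frames.

(** * Projections to the summands *)

Section cr_projections.
Variables (R : realType) (n m : nat) (M : manifold R m).
Variables (T0 : subspaces M) (zeta : vector_field M).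
Local Notation C := R[i].
Implicit Types (p q : M) (U V : set M) (f g : M -> C).
Implicit Types (X Y : vector_field M).
Hypothesis m_eq : m = (n.-1 + (n.-1 + 1))%N.
Hypothesis T0_bundle : subbundle n.-1 T0.
Hypothesis T0_conj : forall p, (T0 p :&: conj_subspaces T0 p)%MS = 0.
Hypothesis zeta_smooth : smooth_field setT zeta.
Hypothesis zeta_transversal : forall p, ~~ (zeta p <= T0 p + conj_subspaces T0 p)%MS.

Local Notation S := (summand T0 zeta).

Lemma rank_T0 p : \rank (T0 p) = n.-1.
Proof.
have [U [_ Up] [F [_ /(_ p Up)[Ff /eqmxP ->]]]] := T0_bundle p.
by apply/eqP.
Qed.

Lemma sum_summands p : (\sum_(k < 3) S k p :=: S iZ p + (S iB p + S iT p))%MS.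
Proof.
rewrite !big_ord_recl big_ord0.
have -> : lift ord0 (lift ord0 ord0) = iT by apply/val_inj.
have -> : lift ord0 ord0 = iB :> 'I_3 by apply/val_inj.
have -> : ord0 = iZ :> 'I_3 by apply/val_inj.
by do 2!apply: adds_eqmx => //; exact: addsmx0.
Qed.

Lemma rank_zeta p : \rank (zeta p) = 1.
Proof.
rewrite rank_rV; case: eqP => // z0; have := zeta_transversal p.
by rewrite z0 sub0mx.
Qed.

Lemma rank_conj p : \rank (conj_subspaces T0 p) = n.-1.
Proof. by rewrite /conj_subspaces mxrank_map rank_T0. Qed.

Lemma rank_summands p : \rank (\sum_(k < 3) S k p)%MS = m.
Proof.
transitivity (n.-1 + (n.-1 + 1))%N; last exact/esym.
rewrite sum_summands mxrank_disjoint_sum; last first.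
  (* A nonzero subspace of a line is the whole line, so a nontrivial intersection would put [zeta p]
     into the sum of the other two summands. *)
  apply/eqP; apply: contraR (zeta_transversal p) => cap0.
  set K := (_ :&: _)%MS in cap0.
  have KZ : (K <= zeta p)%MS by rewrite -(genmxE (zeta p)); exact: capmxSl.
  have KT : (K <= T0 p + conj_subspaces T0 p)%MS by rewrite addsmxC; exact: capmxSr.
  apply: submx_trans KT; rewrite -(geq_leqif (mxrank_leqif_sup KZ)).
  by rewrite rank_zeta lt0n mxrank_eq0.
rewrite genmxE rank_zeta mxrank_disjoint_sum; last by rewrite capmxC; exact: T0_conj.
by rewrite /= rank_T0 rank_conj addnC addnA.
Qed.

Lemma summands_full p : (1%:M <= \sum_(k < 3) S k p)%MS.
Proof. by rewrite sub1mx /row_full rank_summands. Qed.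

Lemma summands_direct p : mxdirect (\sum_(k < 3) S k p).
Proof.
apply/mxdirectP; rewrite /= rank_summands [LHS]m_eq !big_ord_recl big_ord0 /=.
by rewrite genmxE rank_zeta rank_T0 rank_conj addn0 [RHS]addnC addnA.
Qed.

Lemma projectE (u : 'I_3 -> 'rV[C]_m) X p k :
  (forall k, u k <= S k p)%MS -> X p = \sum_k u k ->
  project T0 zeta k X p = u k.
Proof.
move=> uS XE; have /mxdirect_sumsP dx := summands_direct p.
rewrite /project XE (bigD1 k)//= mulmxDl proj_mx_id; [|exact: dx|exact: uS].
rewrite proj_mx_0 ?addr0//; first exact: dx.
by apply: summx_sub_sums.
Qed.

Lemma project_sub k X p : (project T0 zeta k X p <= S k p)%MS.
Proof. exact: proj_mx_sub. Qed.

Lemma project_decomp X p : exists2 u : 'I_3 -> 'rV[C]_m,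
  forall k, (u k <= S k p)%MS & X p = \sum_k u k.
Proof.
have : (X p <= \sum_(k < 3) S k p)%MS.
  by apply: submx_trans (summands_full p); exact: submx1.
by move=> /sub_sumsmxP[u ->]; exists (fun k => u k *m S k p) => // k; exact: submxMl.
Qed.

Lemma project_sum X : \sum_k project T0 zeta k X = X.
Proof.
apply/funext => p; rewrite fct_sumE; have [u uS XE] := project_decomp X p.
by rewrite XE; apply: eq_bigr => k _; rewrite (projectE k uS XE).
Qed.

Lemma project_id k X p : (X p <= S k p)%MS -> project T0 zeta k X p = X p.
Proof.
move=> Xk; rewrite (@projectE (fun j => if j == k then X p else 0) _ _ k); first by rewrite eqxx.
  by move=> j; case: eqP => [->//|_]; exact: sub0mx.
by rewrite (bigD1 k)//= eqxx big1 ?addr0// => j /negbTE ->.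
Qed.

Lemma project_0 k l X p : (X p <= S k p)%MS -> l != k -> project T0 zeta l X p = 0.
Proof.
move=> Xk lk; rewrite (@projectE (fun j => if j == k then X p else 0) _ _ l).
- by rewrite (negbTE lk).
- by move=> j; case: eqP => [->//|_]; exact: sub0mx.
by rewrite (bigD1 k)//= eqxx big1 ?addr0// => j /negbTE ->.
Qed.

Lemma projectD k X Y : project T0 zeta k (X + Y) = project T0 zeta k X + project T0 zeta k Y.
Proof. by apply/funext => p; rewrite /project mulmxDl. Qed.

(** The equation [m_eq] cuts the indices into blocks: a frame of [T0], its conjugate, and [zeta]. *)
Definition frame_type (i : 'I_m) : 'I_3 :=
  match fintype.split (cast_ord m_eq i) with
  | inl _ => iT | inr j => match fintype.split j with inl _ => iB | inr _ => iZ end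
  end.

Lemma adapted_frame p : exists2 U, open_nbhs p U &
  exists G : 'I_m -> vector_field M, [/\ forall i, smooth_field U (G i),
    forall q, U q -> forall i, (G i q <= S (frame_type i) q)%MS &
    forall q, U q -> row_free (\matrix_i G i q)].
Proof.
have [U [Uo Up] [F [Fs FT]]] := T0_bundle p; exists U => //.
have zs : smooth_field U zeta by move=> V f Vo _; exact: zeta_smooth.
pose G i := match fintype.split (cast_ord m_eq i) with
  | inl i => F i
  | inr j => match fintype.split j with inl j => conj_field (F j) | inr _ => zeta end
  end.
have FT0 q i : U q -> (F i q <= T0 q)%MS.
  move=> Uq; have [_ /eqmxP ->] := FT q Uq.
  by rewrite -(rowK (F^~ q)); exact: row_sub.
have FB q i : U q -> (conj_field (F i) q <= conj_subspaces T0 q)%MS.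
  by move=> Uq; rewrite /conj_field /conj_subspaces map_submx; exact: FT0.
exists G; split=> [i|q Uq i|q Uq].
- rewrite /G; case: fintype.split => // j; case: fintype.split => // k.
  exact: smooth_field_conj.
- rewrite /G /frame_type; case: fintype.split => [j|j] /=; first exact: FT0.
  by case: fintype.split => k /=; [exact: FB|rewrite genmxE].
set Gm := \matrix_i G i q.
have Gsub i : (G i q <= Gm)%MS by rewrite -(rowK (G^~ q)); exact: row_sub.
(* For a square matrix independence of the rows follows from their spanning, which is checked
   summand by summand. *)
rewrite row_free_unit -row_full_unit -sub1mx.
apply: submx_trans (summands_full q) _; apply/sumsmx_subP => k _.
have Fsub : (T0 q <= Gm)%MS.
  have [_ /eqmxP ->] := FT q Uq; apply/row_subP => i; rewrite rowK.
  have := Gsub (cast_ord (esym m_eq) (lshift _ i)).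
  by rewrite /G cast_ordKV (unsplitK (inl i)).
have Bsub : (conj_subspaces T0 q <= Gm)%MS.
  have [_ /eqmxP TE] := FT q Uq.
  have : (conj_subspaces T0 q <= map_mx conjc (\matrix_i F i q))%MS.
    by rewrite /conj_subspaces map_submx TE.
  move=> /submx_trans; apply; apply/row_subP => i; rewrite -map_row rowK.
  have := Gsub (cast_ord (esym m_eq) (rshift _ (lshift _ i))).
  by rewrite /G cast_ordKV (unsplitK (inr (lshift 1 i))) (unsplitK (inl i)).
have Zsub : (zeta q <= Gm)%MS.
  have := Gsub (cast_ord (esym m_eq) (rshift _ (rshift _ 0))).
  by rewrite /G cast_ordKV (unsplitK (inr (rshift _ 0))) (unsplitK (inr 0)).
by case: k => [[|[|[|//]]] k3] /=; rewrite ?genmxE.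
Qed.

(** In an adapted frame [X] has smooth coefficients, and projecting keeps those of type [k]. *)
Lemma smooth_project k X : smooth_field setT X ->
  smooth_field setT (project T0 zeta k X).
Proof.
move=> Xs V f Vo _ fs; apply: smooth_fun_local => p Vp.
have [U [Uo Up] [G [Gs GS Gfree]]] := adapted_frame p.
have XUs : smooth_field U X by move=> W h Wo _; exact: Xs.
have [W [Wo Wp WU [g [gs gE]]]] := frame_coefficients Uo Up Gs Gfree XUs.
exists (W `&` V); split; [exact: openI|by []|].
have WVo : open (W `&` V) by exact: openI.
apply: (@eq_smooth_fun _ _ _ _ (fun q =>
  \sum_i (if frame_type i == k then g i q else 0) * vact (G i) f q)) => //.
  move=> q [Wq Vq]; apply/esym/vact_lincomb.
  rewrite (projectE k (u := fun l => \sum_(i | frame_type i == l) g i q *: G i q)).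
  - rewrite [LHS]big_mkcond; apply: eq_bigr => i _.
    by case: eqP => // _; rewrite scale0r.
  - move=> l; apply: summx_sub => i /eqP <-; apply: scalemx_sub.
    by apply: GS; exact: WU.
  rewrite gE// (partition_big frame_type xpredT)//.
apply: smooth_fun_sum => // i _; apply: smooth_funM => //.
  case: eqP => _; last exact: smooth_fun_cst.
  by apply: sub_smooth_fun (gs i) => q [].
apply: Gs => //; first by move=> q [/WU].
by apply: sub_smooth_fun fs => q [].
Qed.

End cr_projections.

(** * Exterior algebra over a module with a bracket *)

Section zmodule_normalization.
Variable W : zmodType.

Inductive zexp := ZVar of nat | ZAdd of zexp & zexp | ZOpp of zexp | ZNil.

Fixpoint zeval (e : seq W) x := match x with
  | ZVar i => e`_i
  | ZAdd x y => zeval e x + zeval e y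
  | ZOpp x => - zeval e x
  | ZNil => 0
  end.

Fixpoint zcoef x (i : nat) : int := match x with
  | ZVar j => (i == j)%:R
  | ZAdd x y => zcoef x i + zcoef y i
  | ZOpp x => - zcoef x i
  | ZNil => 0
  end.

Lemma zevalE e x : zeval e x = \sum_(i < size e) e`_i *~ zcoef x i.
Proof.
elim: x => [j|x IHx y IHy|x IH|] /=.
- have [je|je] := ltnP j (size e).
    rewrite (bigD1 (Ordinal je))//= eqxx big1 ?addr0// => i /negbTE ij.
    by rewrite -val_eqE /= in ij; rewrite ij.
  rewrite nth_default// big1// => i _.
  by rewrite (ltn_eqF (leq_trans (ltn_ord i) je)).
- by rewrite IHx IHy -big_split; apply: eq_bigr => i _; rewrite mulrzDr.
- by rewrite IH -sumrN; apply: eq_bigr => i _; rewrite mulrNz.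
- by rewrite big1.
Qed.

(** Proof by reflection: an expression is determined by the integer coefficients of its atoms, which
    are compared by computation. *)
Lemma zeval_eq e x y :
  all (fun i => zcoef x i == zcoef y i) (iota 0 (size e)) ->
  zeval e x = zeval e y.
Proof.
move=> /allP xy; rewrite !zevalE; apply: eq_bigr => i _.
by rewrite (eqP (xy i _))// mem_iota /=.
Qed.

End zmodule_normalization.

(* [ring] does not apply to identities in a mere [zmodType]. *)
Ltac zmem x l := lazymatch l with
  | nil => constr:(false)
  | x :: _ => constr:(true)
  | _ :: ?l' => zmem x l'
  end.
Ltac zatoms t l := lazymatch t with
  | (?a + ?b)%R => let l' := zatoms a l in zatoms b l'
  | (- ?a)%R => zatoms a l
  | 0%R => l
  | _ => let b := zmem t l in
    lazymatch b with true => l | false => constr:(t :: l) end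
  end.
Ltac zindex x l := lazymatch l with
  | x :: _ => constr:(0%N)
  | _ :: ?l' => let n := zindex x l' in constr:(n.+1)
  end.
Ltac zquote t l := lazymatch t with
  | (?a + ?b)%R => let a' := zquote a l in let b' := zquote b l in
      constr:(ZAdd a' b')
  | (- ?a)%R => let a' := zquote a l in constr:(ZOpp a')
  | 0%R => constr:(ZNil)
  | _ => let n := zindex t l in constr:(ZVar n)
  end.
Ltac zmodule := lazymatch goal with |- @eq ?T ?a ?b =>
  let l := zatoms a (@nil T) in let l := zatoms b l in
  let a' := zquote a l in let b' := zquote b l in
  exact: (@zeval_eq _ l a' b' isT)
  end.

(** * Contractions, Cartan's formula and the Frolicher-Nijenhuis bracket *)

Section multilinear.
Variables V W : zmodType.
Implicit Types (w u : seq V -> W) (s t : seq V) (X Y Z : V) (A B : V -> V).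

Definition multiadditive w := forall s1 X Y s2,
  w (s1 ++ (X + Y) :: s2) = w (s1 ++ X :: s2) + w (s1 ++ Y :: s2).

Definition skew w := forall s1 X Y s2,
  w (s1 ++ X :: Y :: s2) = - w (s1 ++ Y :: X :: s2).

Definition aform w := multiadditive w /\ skew w.

Definition int_mult X w : seq V -> W := fun s => w (X :: s).

(** This is the contraction [i_A], which applies [A] to each argument in turn. The recursion makes
    [[i_X, i_A] = i_(A X)] true by computation, as stated in [int_mult_ext]. *)
Fixpoint derivation_ext A w s : W := if s is X :: s' then
  w (A X :: s') + derivation_ext A (int_mult X w) s' else 0.

Lemma multiadditive_int X w : multiadditive w -> multiadditive (int_mult X w).
Proof. by move=> wD s1 Y Z s2; exact: (wD (X :: s1)). Qed.

Lemma skew_int X w : skew w -> skew (int_mult X w).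
Proof. by move=> wC s1 Y Z s2; exact: (wC (X :: s1)). Qed.

Lemma aform_int X w : aform w -> aform (int_mult X w).
Proof. by move=> [wD wC]; split; [exact: multiadditive_int|exact: skew_int]. Qed.

Lemma form_headD w X Y s : multiadditive w ->
  w (X + Y :: s) = w (X :: s) + w (Y :: s).
Proof. by move=> wD; exact: (wD [::]). Qed.

Lemma form0 w s1 s2 : multiadditive w -> w (s1 ++ 0 :: s2) = 0.
Proof.
move=> wD; have := wD s1 0 0 s2; rewrite addr0 => /eqP.
by rewrite -subr_eq0 opprD addrA subrr sub0r oppr_eq0 => /eqP.
Qed.

Lemma int_mult0 w : multiadditive w -> int_mult 0 w = 0.
Proof. by move=> wD; apply/funext => s; exact: (form0 [::]). Qed.

Lemma formN w s1 X s2 : multiadditive w -> w (s1 ++ - X :: s2) = - w (s1 ++ X :: s2).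
Proof.
move=> wD; apply/eqP; rewrite -addr_eq0 -wD addNr; apply/eqP.
exact: form0.
Qed.

Lemma form_head0 w s : multiadditive w -> w (0 :: s) = 0.
Proof. exact: (form0 [::]). Qed.

Lemma form_headN w X s : multiadditive w -> w (- X :: s) = - w (X :: s).
Proof. exact: (@formN _ [::]). Qed.

Lemma form_sum w (I : Type) (r : seq I) (P : pred I) (F : I -> V) s :
  multiadditive w ->
  w (\sum_(i <- r | P i) F i :: s) = \sum_(i <- r | P i) w (F i :: s).
Proof.
move=> wD; apply: (big_morph (fun X => w (X :: s))) => [X Y|].
  exact: (wD [::]).
exact: (form0 [::]).
Qed.

Lemma head_swap w X Y s : skew w -> w (X :: Y :: s) = - w (Y :: X :: s).
Proof. by move=> wC; exact: (wC [::]). Qed.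

Lemma int_multC w X Y : skew w ->
  int_mult X (int_mult Y w) = - int_mult Y (int_mult X w).
Proof. by move=> wC; apply/funext => s; exact: head_swap. Qed.

Lemma derivation_ext_eq0 A s : derivation_ext A 0 s = 0.
Proof. by elim: s => //= X s IH; rewrite add0r [int_mult X 0](_ : _ = 0). Qed.

Lemma addfE w u s : (w + u) s = w s + u s. Proof. by []. Qed.

Lemma int_multD X w u : int_mult X (w + u) = int_mult X w + int_mult X u.
Proof. by []. Qed.

Lemma derivation_extD A w u s :
  derivation_ext A (w + u) s = derivation_ext A w s + derivation_ext A u s.
Proof.
elim: s w u => /= [|X s IH] w u; first by rewrite addr0.
by rewrite int_multD IH addfE addrACA.
Qed.

Lemma derivation_extN A w s :
  derivation_ext A (- w) s = - derivation_ext A w s.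
Proof.
by apply/eqP; rewrite -addr_eq0 -derivation_extD addNr derivation_ext_eq0.
Qed.

Lemma derivation_ext_fD A B w s : multiadditive w ->
  derivation_ext (fun X => A X + B X) w s =
  derivation_ext A w s + derivation_ext B w s.
Proof.
elim: s w => /= [|X s IH] w wD; first by rewrite addr0.
rewrite form_headD// (IH _ (multiadditive_int _ wD)); zmodule.
Qed.

Lemma derivation_ext_fN A w s : multiadditive w ->
  derivation_ext (fun X => - A X) w s = - derivation_ext A w s.
Proof.
elim: s w => /= [|X s IH] w wD; first by rewrite oppr0.
rewrite form_headN// (IH _ (multiadditive_int _ wD)); zmodule.
Qed.

Lemma eq_derivation_ext A B w s : A =1 B ->
  derivation_ext A w s = derivation_ext B w s.
Proof. by move=> AB; elim: s w => //= X s IH w; rewrite AB IH. Qed.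

Lemma int_mult_ext A X w :
  int_mult X (derivation_ext A w) =
  int_mult (A X) w + derivation_ext A (int_mult X w).
Proof. by []. Qed.

Lemma multiadditive_ext A w : {morph A : X Y / X + Y} -> multiadditive w ->
  multiadditive (derivation_ext A w).
Proof.
move=> AD wD s1; elim: s1 w wD => [|Z s1 IH] w wD X Y s2 /=.
  have -> : int_mult (X + Y) w = int_mult X w + int_mult Y w.
    by apply/funext => t; exact: form_headD.
  rewrite AD form_headD// derivation_extD; zmodule.
have := wD (A Z :: s1) X Y s2 => /= ->.
rewrite (IH _ (multiadditive_int _ wD)); zmodule.
Qed.

Lemma aform_ext A w : {morph A : X Y / X + Y} -> aform w ->
  aform (derivation_ext A w).
Proof.
move=> AD wF; split; first by apply: multiadditive_ext => //; have [] := wF.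
move=> s1; elim: s1 w wF => [|Z s1 IH] w wF X Y s2 /=.
  have [_ wC] := wF.
  rewrite (int_multC Y X wC) derivation_extN /int_mult.
  rewrite (head_swap (A X) Y _ wC) (head_swap X (A Y) _ wC); zmodule.
have [_ /(_ (A Z :: s1)) /= ->] := wF.
by rewrite (IH _ (aform_int _ wF)) opprD.
Qed.

Lemma derivation_ext_comp A B w s : multiadditive w ->
  derivation_ext A (derivation_ext B w) s =
  derivation_ext B (derivation_ext A w) s +
  derivation_ext (fun X => B (A X) - A (B X)) w s.
Proof.
elim: s w => /= [|X s IH] w wD; first by rewrite addr0.
rewrite !int_mult_ext !derivation_extD (IH _ (multiadditive_int _ wD)).
rewrite form_headD// form_headN//; zmodule.
Qed.

(** The contraction by a vector-valued 2-form. Either the head is the first argument of [N], or it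
    is passed over: exchanging it with the two arguments of [N] is even, with the inserted vector
    odd, hence the minus sign. *)
Fixpoint ext2 (N : V -> V -> V) w s : W := if s is X :: s' then
  derivation_ext (N X) w s' - ext2 N (int_mult X w) s' else 0.

Section differential.
Variables (a : V -> W -> W) (br : V -> V -> V).
Hypothesis aDl : forall X Y f, a (X + Y) f = a X f + a Y f.
Hypothesis aDr : forall X, {morph a X : f g / f + g}.
Hypothesis brDl : forall X Y Z, br (X + Y) Z = br X Z + br Y Z.
Hypothesis brDr : forall X, {morph br X : Y Z / Y + Z}.
Hypothesis brC : forall X Y, br X Y = - br Y X.

Lemma act0r X : a X 0 = 0.
Proof. by apply: (addIr (a X 0)); rewrite -aDr !add0r. Qed.

Lemma actNr X f : a X (- f) = - a X f.
Proof. by apply/eqP; rewrite -addr_eq0 -aDr addNr act0r. Qed.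

(* Cartan's formula [i_X d = L_X - d i_X], read as a recursion on the number
   of arguments. *)
Fixpoint exterior w s : W := if s is X :: s' then
  a X (w s') - derivation_ext (br X) w s' - exterior (int_mult X w) s' else 0.

Lemma int_mult_exterior X w : int_mult X (exterior w) =
  (a X \o w) - derivation_ext (br X) w - exterior (int_mult X w).
Proof. by []. Qed.

Lemma exterior0 s : exterior 0 s = 0.
Proof.
elim: s => //= X s IH.
by rewrite [int_mult X 0](_ : _ = 0)// IH derivation_ext_eq0 act0r !subr0.
Qed.

Lemma exteriorD w u s : exterior (w + u) s = exterior w s + exterior u s.
Proof.
elim: s w u => /= [|X s IH] w u; first by rewrite addr0.
rewrite int_multD IH derivation_extD.
rewrite addfE aDr.
zmodule.
Qed.

Lemma exteriorN w s : exterior (- w) s = - exterior w s.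
Proof. by apply/eqP; rewrite -addr_eq0 -exteriorD addNr exterior0. Qed.

Lemma multiadditive_exterior w : multiadditive w -> multiadditive (exterior w).
Proof.
move=> wD s1; elim: s1 w wD => [|Z s1 IH] w wD X Y s2 /=.
  have -> : int_mult (X + Y) w = int_mult X w + int_mult Y w.
    by apply/funext => t; exact: (wD [::]).
  rewrite (eq_derivation_ext _ _ (brDl X Y)) derivation_ext_fD// exteriorD aDl.
  zmodule.
rewrite (wD s1) (multiadditive_ext (brDr Z) wD) (IH _ (multiadditive_int _ wD)) aDr.
zmodule.
Qed.

Lemma aform_exterior w : aform w -> aform (exterior w).
Proof.
move=> wF; split; first by apply: multiadditive_exterior; have [] := wF.
move=> s1; elim: s1 w wF => [|Z s1 IH] w wF X Y s2 /=.
  have [wD wC] := wF.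
  rewrite (int_multC Y X wC) exteriorN (brC X Y) form_headN// /int_mult; zmodule.
have [_ ->] := wF; have [_ ->] := aform_ext (brDr Z) wF.
rewrite (IH _ (aform_int _ wF)) actNr; zmodule.
Qed.

Lemma a_derivation_ext X A w s :
  derivation_ext A (a X \o w) s = a X (derivation_ext A w s).
Proof.
elim: s w => /= [|Y s IH] w; first by rewrite act0r.
by rewrite aDr -IH.
Qed.

Section nijenhuis.
Variables phi psi : V -> V.
Hypothesis phiD : {morph phi : X Y / X + Y}.
Hypothesis psiD : {morph psi : X Y / X + Y}.
Hypothesis phipsi : forall X, phi (psi X) = 0.
Hypothesis psiphi : forall X, psi (phi X) = 0.

Local Notation i := derivation_ext.
Local Notation d := exterior.

(** The general Frolicher-Nijenhuis bracket has a further term, [phi psi + psi phi] applied to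
    [br X Y], which is zero here. *)
Definition nijenhuis X Y := br (phi X) (psi Y) + br (psi X) (phi Y)
  - phi (br X (psi Y) + br (psi X) Y) - psi (br (phi X) Y + br X (phi Y)).

Lemma ext_comm w : multiadditive w -> i phi (i psi w) = i psi (i phi w).
Proof.
move=> wD; apply/funext => s; rewrite derivation_ext_comp//.
have -> : i (fun X => psi (phi X) - phi (psi X)) w s = i (fun=> 0) w s.
  by apply: eq_derivation_ext => X; rewrite psiphi phipsi subrr.
suff -> : i (fun=> 0) w s = 0 by rewrite addr0.
elim: s w wD => //= X s IH w wD.
by rewrite (IH _ (multiadditive_int _ wD)) form_head0// addr0.
Qed.

Lemma derivation_ext_add A w u : i A (w + u) = i A w + i A u.
Proof. by apply/funext => s; exact: derivation_extD. Qed.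

Lemma derivation_ext_opp A w : i A (- w) = - i A w.
Proof. by apply/funext => s; exact: derivation_extN. Qed.

Lemma exterior_add w u : d (w + u) = d w + d u.
Proof. by apply/funext => s; exact: exteriorD. Qed.

Lemma addfN w s : (- w) s = - w s. Proof. by []. Qed.

Lemma ext_int_exterior A Y w s : i A (int_mult Y (d w)) s =
  a Y (i A w s) - i A (i (br Y) w) s - i A (d (int_mult Y w)) s.
Proof.
rewrite int_mult_exterior !derivation_ext_add !derivation_ext_opp.
by rewrite !addfE !addfN a_derivation_ext.
Qed.

(** Brings the head argument outside all three operators; [B (A X) = 0] removes the term in which
    [A] and [B] both act on it. *)
Lemma ext_exterior_ext_cons A B X w s : (forall Y, B (A Y) = 0) ->
  multiadditive w -> i A (d (i B w)) (X :: s) =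
  a (A X) (i B w s) - i (br (A X)) (i B w) s - d (i B (int_mult (A X) w)) s
  + (a X (i A (i B w) s) - i A (i (br X) (i B w)) s
  - i A (d (int_mult (B X) w)) s - i A (d (i B (int_mult X w))) s).
Proof.
move=> BA wD.
transitivity (d (i B w) (A X :: s) + i A (int_mult X (d (i B w))) s) => //.
rewrite ext_int_exterior int_mult_ext exterior_add derivation_ext_add addfE.
have -> : d (i B w) (A X :: s) = a (A X) (i B w s) - i (br (A X)) (i B w) s
   - d (int_mult (A X) (i B w)) s by [].
rewrite int_mult_ext BA (int_mult0 wD) add0r; zmodule.
Qed.

Lemma int_mult_ext_ext X w : multiadditive w ->
  int_mult X (i psi (i phi w)) = i phi (int_mult (psi X) w) +
    (i psi (int_mult (phi X) w) + i psi (i phi (int_mult X w))).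
Proof.
move=> wD; rewrite !int_mult_ext derivation_ext_add phipsi (int_mult0 wD) add0r.
by [].
Qed.

(* Both sides anticommute with [i_X] up to the insertion of [nijenhuis X], so
   they agree by induction on the degree. *)
Theorem nijenhuis_commutator w s : aform w ->
  ext2 nijenhuis w s =
  i phi (d (i psi w)) s + i psi (d (i phi w)) s
  - d (i psi (i phi w)) s - i psi (i phi (d w)) s.
Proof.
elim: s w => [|X s IH] w wF; first by rewrite /=; zmodule.
have [wD _] := wF.
have dwD : multiadditive (d w) by exact: multiadditive_exterior.
have -> : ext2 nijenhuis w (X :: s) =
  i (nijenhuis X) w s - ext2 nijenhuis (int_mult X w) s by [].
rewrite (IH _ (aform_int _ wF)) !ext_exterior_ext_cons//.
have -> : d (i psi (i phi w)) (X :: s) = a X (i psi (i phi w) s) -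
  i (br X) (i psi (i phi w)) s - d (int_mult X (i psi (i phi w))) s by [].
have -> : i psi (i phi (d w)) (X :: s) = int_mult X (i psi (i phi (d w))) s by [].
rewrite !int_mult_ext_ext// !exterior_add !addfE !ext_int_exterior.
have -> : i psi (i phi (int_mult X (d w))) s =
    a X (i psi (i phi w) s) - i psi (i phi (i (br X) w)) s
    - i psi (i phi (d (int_mult X w))) s.
  rewrite int_mult_exterior !derivation_ext_add !derivation_ext_opp.
  rewrite !addfE !addfN.
  have -> : i phi (a X \o w) = a X \o i phi w.
    by apply/funext => t; exact: a_derivation_ext.
  by rewrite a_derivation_ext.
(* [D] is the endomorphism with [[i_(br X), i_psi] = i_D]. *)
pose D Z := psi (br X Z) - br X (psi Z).
have brXw : multiadditive (i (br X) w) by exact: multiadditive_ext.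
have phiw : multiadditive (i phi w) by exact: multiadditive_ext.
have DE u t : multiadditive u ->
    i (br X) (i psi u) t = i psi (i (br X) u) t + i D u t.
  by move=> uD; exact: derivation_ext_comp.
have DEf : i (br X) (i psi w) = i psi (i (br X) w) + i D w.
  by apply/funext => t; exact: DE.
(* The bracket with [X] inserted is a combination of commutators of endomorphisms. Their
   contractions are commutators of contractions, which leaves an identity between words in the
   operators. *)
have NE : i (nijenhuis X) w s =
    - i (fun Z => psi (br (phi X) Z) - br (phi X) (psi Z)) w s
    + (- i (fun Z => phi (br (psi X) Z) - br (psi X) (phi Z)) w s
    + i (fun Z => phi (D Z) - D (phi Z)) w s).
  rewrite -!derivation_ext_fN// -!derivation_ext_fD//.
  apply: eq_derivation_ext => Z; rewrite /nijenhuis /D.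
  have phiN Y : phi (- Y) = - phi Y.
    apply/eqP; rewrite -addr_eq0 -phiD addNr.
    by apply/eqP/(addIr (phi 0)); rewrite -phiD !add0r.
  rewrite psiphi !phiD !psiD !phiN phipsi.
  have -> : br X 0 = 0 by apply: (addIr (br X 0)); rewrite -brDr !add0r.
  zmodule.
rewrite NE.
rewrite (@derivation_ext_comp (br (phi X)) psi w s wD).
rewrite (@derivation_ext_comp (br (psi X)) phi w s wD).
rewrite DE// DEf derivation_ext_add addfE.
rewrite (@derivation_ext_comp D phi w s wD).
rewrite (ext_comm wD) (ext_comm brXw).
zmodule.
Qed.

End nijenhuis.
End differential.
End multilinear.

(** * The invariant formula for the differential *)

Section sums.
Variables V W : zmodType.
Implicit Types (w : seq V -> W) (s t : seq V) (X Y Z : V).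

(** Plays the role of [(-1) ^+ i *: x] in a group without scalars. *)
Definition signed (i : nat) (x : W) := if odd i then - x else x.

Lemma signedS i x : signed i.+1 x = - signed i x.
Proof. by rewrite /signed /=; case: (odd i); rewrite ?opprK. Qed.

Lemma signedN i x : signed i (- x) = - signed i x.
Proof. by rewrite /signed; case: (odd i). Qed.

Lemma signed_sum i (I : Type) (r : seq I) (P : pred I) (F : I -> W) :
  signed i (\sum_(j <- r | P j) F j) = \sum_(j <- r | P j) signed i (F j).
Proof. by rewrite /signed; case: (odd i); rewrite ?sumrN. Qed.

Lemma signedD i j x : signed (i + j) x = signed i (signed j x).
Proof. by elim: i => //= i IH; rewrite addSn !signedS IH. Qed.

Definition delete (T : Type) i (s : seq T) := take i s ++ drop i.+1 s.

Lemma delete0 (T : Type) (x : T) (s : seq T) : delete 0 (x :: s) = s.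
Proof. by rewrite /delete /= drop0. Qed.

Lemma deleteS (T : Type) i (x : T) (s : seq T) : delete i.+1 (x :: s) = x :: delete i s.
Proof. by []. Qed.

(** Moving the modified argument to the front costs the sign of its position. *)
Lemma derivation_ext_sum A w s : skew w ->
  derivation_ext A w s =
  \sum_(j < size s) signed j (w (A s`_j :: delete j s)).
Proof.
elim: s w => [|X s IH] w wF /=; first by rewrite big_ord0.
rewrite big_ord_recl delete0 (IH _ (skew_int _ wF)); congr (_ + _).
apply: eq_bigr => j _; rewrite deleteS /= signedS.
by rewrite (head_swap _ _ _ wF) signedN opprK.
Qed.

Definition alternating_sum (a : V -> W -> W) (br : V -> V -> V) w s : W :=
  \sum_(i < size s) signed i (a s`_i (w (delete i s)))
  + \sum_(i < size s) \sum_(j < size s | (i < j)%N)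
      signed (i + j) (w (br s`_i s`_j :: delete i (delete j s))).

(** Cartan's recursion appears when the index [0] is split off: its anchor term is [a X], the pairs
    [(0, j)] give the derivation by [br X], and the other terms form the same sum for
    [int_mult X w], with the opposite sign. *)
Lemma alternating_sumE (a : V -> W -> W) (br : V -> V -> V) w s :
  (forall X f, a X (- f) = - a X f) -> skew w ->
  alternating_sum a br w s = exterior a br w s.
Proof.
move=> aN; rewrite /alternating_sum; elim: s w => [|X s IH] w wF /=.
  by rewrite !big_ord0 addr0.
rewrite -(IH _ (skew_int _ wF)) !big_ord_recl delete0 /=.
have -> : \sum_(i < size s) signed (lift ord0 i)
    (a s`_i (w (delete (lift ord0 i) (X :: s)))) =
    - \sum_(i < size s) signed i (a s`_i (int_mult X w (delete i s))).
  by rewrite -sumrN; apply: eq_bigr => i _; rewrite deleteS signedS.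
have -> : \sum_(j < (size s).+1 | (0 < j)%N) signed (0 + j)
    (w (br X (X :: s)`_j :: delete 0 (delete j (X :: s)))) =
    - derivation_ext (br X) w s.
  rewrite (derivation_ext_sum _ _ wF) -sumrN big_mkcond big_ord_recl /= add0r.
  by apply: eq_bigr => j _; rewrite deleteS delete0 add0n signedS.
have -> : \sum_(i < size s) \sum_(j < (size s).+1 | (lift ord0 i < j)%N)
    signed (lift ord0 i + j) (w (br s`_i (X :: s)`_j ::
      delete (lift ord0 i) (delete j (X :: s)))) =
    - \sum_(i < size s) \sum_(j < size s | (i < j)%N)
      signed (i + j) (int_mult X w (br s`_i s`_j :: delete i (delete j s))).
  rewrite -sumrN; apply: eq_bigr => i _; rewrite -sumrN.
  rewrite big_mkcond big_ord_recl /= add0r [RHS]big_mkcond.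
  apply: eq_bigr => j _ /=; rewrite !deleteS /bump /= !add1n ltnS.
  case: ifP => // _; rewrite addSn addnS !signedS opprK.
  by rewrite (head_swap _ _ _ wF) signedN.
have H (p q x y : W) : p - x + (- q - y) = p - q - (x + y) by zmodule.
exact: H.
Qed.

End sums.

Lemma big_tuple_cons (W : zmodType) (T : finType) n (P : pred (seq T)) (F : seq T -> W) :
  \sum_(b : n.+1.-tuple T | P b) F b =
  \sum_x \sum_(b : n.-tuple T | P (x :: b)) F (x :: b).
Proof.
rewrite pair_big_dep /=.
rewrite (reindex (fun q : T * n.-tuple T => [tuple of q.1 :: q.2])) //=.
exists (fun b => (thead b, [tuple of behead b])) => [[x b] _|b _] /=.
  by rewrite theadE; congr (_, _); apply/val_inj.
by apply/val_inj; rewrite /= [in RHS](tuple_eta b).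
Qed.

(** An unmarked head is inverted with every later mark, a marked one with none. *)
Lemma inversions_cons x b :
  inversions (x :: b) = ((if x then 0 else count id b) + inversions b)%N.
Proof.
rewrite /inversions /= big_ord_recl; congr (_ + _)%N; last first.
  apply: eq_bigr => i _; rewrite big_mkcond big_ord_recl /= add0n [RHS]big_mkcond.
  by apply: eq_bigr => j _; rewrite /bump /= !add1n ltnS.
rewrite big_mkcond big_ord_recl /= add0n.
case: x => /=; first by rewrite big1.
elim: b => [|y b IH]; first by rewrite big_ord0.
by rewrite big_ord_recl /=; congr (_ + _)%N; rewrite -IH.
Qed.

Lemma perm_eql_swap (T : eqType) (x y : T) s :
  perm_eql [:: x, y & s] [:: y, x & s].
Proof. exact: (perm_catCA [:: x] [:: y] s). Qed.

(** * Shuffle sums by recursion *)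

Section shuffles.
Variables V W : zmodType.
Implicit Types (w : seq V -> W) (s t : seq V) (X Y Z : V).

Definition shuffles q (F : seq V -> seq V -> W) s : W :=
  \sum_(b : (size s).-tuple bool | count id b == q)
    signed (inversions b) (F (mask b s) (mask [seq ~~ x | x <- b] s)).

(** The head goes to the first group, or to the second one past [q] marks, which costs the sign of
    [q]. *)
Lemma shuffles_cons q F X s : shuffles q F (X :: s) =
  (if q is q'.+1 then shuffles q' (fun s1 => F (X :: s1)) s else 0)
  + signed q (shuffles q (fun s1 s2 => F s1 (X :: s2)) s).
Proof.
rewrite /shuffles (@big_tuple_cons _ _ _ (fun b => count id b == q)
  (fun b => signed (inversions b) (F (mask b (X :: s))
     (mask [seq ~~ x | x <- b] (X :: s))))).
rewrite big_bool /=; congr (_ + _).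
  case: q => [|q]; first by rewrite big_pred0.
  by apply: eq_big => [b|b _]; rewrite ?inversions_cons.
rewrite signed_sum; apply: eq_big => [b|b /eqP bq]; first by rewrite add0n.
by rewrite inversions_cons -signedD -bq.
Qed.

Lemma eq_shuffles q F G s : (forall s1 s2, F s1 s2 = G s1 s2) ->
  shuffles q F s = shuffles q G s.
Proof. by move=> FG; apply: eq_bigr => b _; rewrite FG. Qed.

Lemma shufflesN q F s :
  shuffles q (fun s1 s2 => - F s1 s2) s = - shuffles q F s.
Proof. by rewrite /shuffles -sumrN; apply: eq_bigr => b _; rewrite signedN. Qed.

Lemma shuffles_nil q F : shuffles q.+1 F [::] = 0.
Proof. by rewrite /shuffles big1// => b; rewrite tuple0. Qed.

Lemma shuffles0 F s : shuffles 0 F s = F [::] s.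
Proof.
elim: s F => [|X s IH] F; last by rewrite shuffles_cons add0r IH.
rewrite /shuffles (bigD1 [tuple])//= big1 => [|b]; last by rewrite tuple0.
by rewrite /inversions big_ord0 addr0.
Qed.

Definition contraction q (u : seq V -> V) w :=
  shuffles q (fun s1 s2 => w (u s1 :: s2)).

Lemma contraction0 u w s : contraction 0 u w s = w (u [::] :: s).
Proof. exact: shuffles0. Qed.

(** Passing over [X] gives the sign of [q.+1] from the shuffle and one more from exchanging [X] with
    the inserted vector, hence that of [q]. *)
Lemma contraction_cons q u w X s : skew w ->
  contraction q.+1 u w (X :: s) =
  contraction q (fun t => u (X :: t)) w s
  + signed q (contraction q.+1 u (int_mult X w) s).
Proof.
move=> wF; rewrite /contraction shuffles_cons; congr (_ + _).
rewrite (@eq_shuffles _ _ (fun s1 s2 => - int_mult X w (u s1 :: s2))).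
  by rewrite shufflesN signedN signedS opprK.
by move=> s1 s2; exact: head_swap.
Qed.

Lemma contraction1 u w s : skew w ->
  contraction 1 u w s = derivation_ext (fun X => u [:: X]) w s.
Proof.
elim: s w => [|X s IH] w wF; first exact: shuffles_nil.
by rewrite contraction_cons// contraction0 (IH _ (skew_int _ wF)).
Qed.

Lemma contraction2 u w s : skew w ->
  contraction 2 u w s = ext2 (fun X Y => u [:: X; Y]) w s.
Proof.
elim: s w => [|X s IH] w wF; first exact: shuffles_nil.
by rewrite contraction_cons// contraction1// (IH _ (skew_int _ wF)).
Qed.

End shuffles.

(** * Components by type of argument *)

Section graded.
Variables (V W : zmodType) (I : finType) (P : I -> V -> V).
Hypothesis PD : forall k, {morph P k : X Y / X + Y}.
Hypothesis P_sum : forall X, \sum_k P k X = X.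
Hypothesis PP : forall k l X, P k (P l X) = if k == l then P l X else 0.
Implicit Types (w : seq V -> W) (s t : seq V) (X Y Z : V).
Implicit Types (Q : pred (seq I)) (tau : seq I).

Definition project_seq tau s := [seq P x.1 x.2 | x <- zip tau s].

(** An arbitrary predicate on type words is allowed because, once a head of type [k] is removed, a
    condition on counts becomes the condition [Q (k :: _)] on the rest. *)
Definition part Q w s : W :=
  \sum_(tau : (size s).-tuple I | Q tau) w (project_seq tau s).

Lemma part_nil Q w : part Q w [::] = if Q [::] then w [::] else 0.
Proof.
rewrite /part big_mkcond (bigD1 [tuple])//= big1 ?addr0// => b.
by rewrite tuple0.
Qed.

Lemma part_cons Q w X s : part Q w (X :: s) =
  \sum_k part (fun tau => Q (k :: tau)) (int_mult (P k X) w) s.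
Proof.
exact: (@big_tuple_cons _ _ _ Q (fun tau => w (project_seq tau (X :: s)))).
Qed.

Lemma eq_part Q1 Q2 w s : Q1 =1 Q2 -> part Q1 w s = part Q2 w s.
Proof. by move=> Q12; apply: eq_bigl => b; exact: Q12. Qed.

Lemma part0 Q s : part Q 0 s = 0.
Proof. by rewrite /part big1. Qed.

Lemma part_pred0 Q w s : Q =1 xpred0 -> part Q w s = 0.
Proof. by move=> Q0; rewrite /part big_pred0// => b; exact: Q0. Qed.

Lemma int_mult_part k Q w X : multiadditive w ->
  int_mult (P k X) (part Q w) = part (fun tau => Q (k :: tau)) (int_mult (P k X) w).
Proof.
move=> wD; apply/funext => s; rewrite /int_mult part_cons (bigD1 k)//= PP eqxx.
rewrite big1 ?addr0// => l lk; rewrite PP (negbTE lk).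
by rewrite (int_mult0 wD) part0.
Qed.

(** On arguments of pure types [tau], projecting along any other word sends some argument to
    zero. *)
Lemma part_project_seq Q w tau s : multiadditive w -> size tau = size s ->
  part Q w (project_seq tau s) = if Q tau then w (project_seq tau s) else 0.
Proof.
elim: s tau Q w => [|X s IH] [|k tau]//= Q w wD; first by rewrite part_nil.
move=> [st]; have /= := congr1 (@^~ (project_seq tau s)) (int_mult_part k Q X wD).
rewrite /project_seq /= /int_mult => ->.
exact: (IH _ (fun tau => Q (k :: tau)) _ (multiadditive_int _ wD) st).
Qed.

Lemma sum_project_seq w s : multiadditive w ->
  \sum_(tau : (size s).-tuple I) w (project_seq tau s) = w s.
Proof.
elim: s w => [|X s IH] w wD.
  by rewrite (bigD1 [tuple])//= big1 ?addr0// => b; rewrite tuple0.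
rewrite (@big_tuple_cons _ _ _ predT (fun tau => w (project_seq tau (X :: s)))) /=.
rewrite -{2}(P_sum X) form_sum//; apply: eq_bigr => k _.
exact: (IH _ (multiadditive_int (P k X) wD)).
Qed.

Section graded_differential.
Variables (b : I) (a : V -> W -> W) (br : V -> V -> V).
Hypothesis aDl : forall X Y f, a (X + Y) f = a X f + a Y f.
Hypothesis aDr : forall X, {morph a X : f g / f + g}.
Hypothesis brDl : forall X Y Z, br (X + Y) Z = br X Z + br Y Z.
Hypothesis brDr : forall X, {morph br X : Y Z / Y + Z}.

Definition graded_act X f := a (P b X) f.

(* The arguments [l] for which [[P k X, P j Y]] contributes its [l]-part are
   those with [{b, l} = {k, j}] as multisets: these are the components of the
   bracket dual to the part of [d] adding one argument of type [b]. *)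
Definition graded_bracket X Y :=
  \sum_k \sum_j \sum_(l | perm_eq [:: b; l] [:: k; j]) P l (br (P k X) (P j Y)).

(** A component is determined by how many arguments of each type it takes, hence the comparison up
    to permutation. *)
Definition one_b_less tau : pred (seq I) := fun tau' => perm_eq (b :: tau') tau.

Lemma proj0 k : P k 0 = 0.
Proof. by apply: (addIr (P k 0)); rewrite -PD !add0r. Qed.

Lemma bracket0r X : br X 0 = 0.
Proof. by apply: (addIr (br X 0)); rewrite -brDr !add0r. Qed.

Lemma bracket0l Y : br 0 Y = 0.
Proof. by apply: (addIr (br 0 Y)); rewrite -brDl !add0r. Qed.

Lemma graded_bracket_PP k j X Y : graded_bracket (P k X) (P j Y) =
  \sum_(l | perm_eq [:: b; l] [:: k; j]) P l (br (P k X) (P j Y)).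
Proof.
rewrite /graded_bracket (bigD1 k)//= (bigD1 j)//= !PP !eqxx.
rewrite [X in _ + X + _]big1 => [|j' jj]; last first.
  by rewrite big1// => l _; rewrite !PP (negbTE jj) bracket0r proj0.
rewrite addr0 [X in _ + X]big1 ?addr0// => k' kk; rewrite big1// => j' _; rewrite big1// => l _.
by rewrite PP (negbTE kk) bracket0l proj0.
Qed.

(** Bracketing the head, of type [j], with [P k X] yields parts of all types [l]. The component
    retains those for which [b :: l :: tau] permutes [k :: j :: tau], that is, exactly the summands
    of [graded_bracket]. *)
Lemma derivation_ext_part k X tau w s : multiadditive w -> size tau = size s ->
  derivation_ext (br (P k X)) (part (one_b_less (k :: tau)) w) (project_seq tau s) =
  derivation_ext (graded_bracket (P k X)) w (project_seq tau s).
Proof.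
elim: s tau w => [|Y s IH] [|j tau]//= w wD [st].
rewrite /project_seq /= -/(project_seq tau s) int_mult_part//; congr (_ + _).
  rewrite graded_bracket_PP form_sum// part_cons [RHS]big_mkcond.
  apply: eq_bigr => l _.
  rewrite (part_project_seq _ (multiadditive_int _ wD) st) /one_b_less.
  congr (if _ then _ else _); exact: (perm_cat2r tau [:: b; l] [:: k; j]).
(* When a later argument is bracketed, the head type [j] occurs on both sides of the permutation
   condition and cancels. *)
rewrite -(IH _ _ (multiadditive_int _ wD) st); congr derivation_ext.
apply/funext => t; apply: eq_part => tau' /=.
rewrite /one_b_less.
rewrite (perm_eql_swap b j) perm_sym (perm_eql_swap k j) perm_cons.
exact: perm_sym.
Qed.

(** Differentiating along the head removes its type [k]; what remains has one [b] less only if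
    [k = b], so the anchor acts through [P b] alone. *)
Lemma exterior_part tau w s : multiadditive w -> size tau = size s ->
  exterior a br (part (one_b_less tau) w) (project_seq tau s) =
  exterior graded_act graded_bracket w (project_seq tau s).
Proof.
elim: s tau w => [|X s IH] [|k tau]//= w wD [st].
rewrite /project_seq /= -/(project_seq tau s) derivation_ext_part//.
congr (_ - _ - _).
  rewrite part_project_seq// /one_b_less /graded_act PP.
  rewrite (perm_cat2r tau [:: b] [:: k]).
  rewrite (_ : perm_eq [:: b] [:: k] = (b == k)).
    case: eqP => // _; rewrite (act0r aDr).
    by apply: (addIr (a 0 (w (project_seq tau s)))); rewrite -aDl !add0r.
  apply/idP/eqP => [/perm_mem/(_ b)|->//].
  by rewrite !inE eqxx => /esym/eqP.
rewrite int_mult_part// -(IH _ _ (multiadditive_int _ wD) st).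
congr exterior; apply/funext => t; apply: eq_part => tau' /=.
by rewrite /one_b_less (perm_eql_swap b k) perm_cons.
Qed.

End graded_differential.
End graded.

Section skew_parts.
Variables (V W : zmodType) (I : finType) (P : I -> V -> V).
Hypothesis PD : forall k, {morph P k : X Y / X + Y}.
Implicit Types (w : seq V -> W) (Q : pred (seq I)).

Lemma partN Q w s : part P Q (- w) s = - part P Q w s.
Proof. by rewrite /part -sumrN. Qed.

Lemma skew_part Q w :
  (forall t1 k l t2, Q (t1 ++ k :: l :: t2) = Q (t1 ++ l :: k :: t2)) ->
  skew w -> skew (part P Q w).
Proof.
move=> + + s1; elim: s1 Q w => [|Z s1 IH] Q w QC wC X Y s2 /=.
  rewrite !part_cons.
  under eq_bigr do rewrite part_cons.
  under [in RHS]eq_bigr do rewrite part_cons.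
  rewrite exchange_big -sumrN; apply: eq_bigr => l _.
  rewrite -sumrN; apply: eq_bigr => k _ /=.
  rewrite int_multC// partN; congr (- _); apply: eq_part => t.
  exact: (QC [::]).
rewrite !part_cons -sumrN; apply: eq_bigr => k _.
apply: IH; last exact: skew_int.
by move=> t1 j l t2; exact: (QC (k :: t1)).
Qed.

End skew_parts.

(** * The operator d' and contraction by the bracket *)

Section bigraded.
Variables (V W : zmodType) (P : 'I_3 -> V -> V).
Hypothesis PD : forall k, {morph P k : X Y / X + Y}.
Hypothesis P_sum : forall X, \sum_k P k X = X.
Hypothesis PP : forall k l X, P k (P l X) = if k == l then P l X else 0.
Variables (a : V -> W -> W) (br : V -> V -> V).
Hypothesis aDl : forall X Y f, a (X + Y) f = a X f + a Y f.
Hypothesis aDr : forall X, {morph a X : f g / f + g}.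
Hypothesis brDl : forall X Y Z, br (X + Y) Z = br X Z + br Y Z.
Hypothesis brDr : forall X, {morph br X : Y Z / Y + Z}.
Hypothesis brC : forall X Y, br X Y = - br Y X.
Implicit Types (w : seq V -> W) (s : seq V) (X Y Z : V).

Definition has_type i p q (tau : seq 'I_3) :=
  [&& count_mem iZ tau == i, count_mem iB tau == p & count_mem iT tau == q].

Definition dprime_sum w s : W :=
  \sum_(i < 2) \sum_(p < size s) \sum_(q < size s)
    part P (has_type i p.+1 q)
      (alternating_sum a br (part P (has_type i p q) w)) s.

(** What is left of [kills2] once one argument in the [iZ] summand has been inserted. *)
Definition kills1 w := forall s1 X s2, w (s1 ++ P iZ X :: s2) = 0.

(** Satisfied by forms since [C zeta] is a line. It makes the types with at most one [iZ], the ones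
    over which [dprime_sum] ranges, account for the whole form. *)
Definition kills2 w := forall s1 X s2 Y s3,
  w (s1 ++ P iZ X :: s2 ++ P iZ Y :: s3) = 0.

Local Notation bracket := (graded_bracket P iB br).
Local Notation act := (graded_act P iB a).

Lemma count_types (tau : seq 'I_3) :
  (count_mem iZ tau + (count_mem iB tau + count_mem iT tau) = size tau)%N.
Proof.
elim: tau => //= k tau <-.
by case: k => [[|[|[|//]]] k3]; rewrite -!val_eqE /= ?add0n ?add1n ?addnS.
Qed.

Lemma perm_eq_types (t1 t2 : seq 'I_3) :
  perm_eq t1 t2 = [&& count_mem iZ t1 == count_mem iZ t2,
    count_mem iB t1 == count_mem iB t2 & count_mem iT t1 == count_mem iT t2].
Proof.
apply/idP/and3P => [/permP E|[/eqP EZ /eqP EB /eqP ET]].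
  by split; apply/eqP; exact: E.
apply/allP => k _ /=; apply/eqP.
have : [|| k == iZ, k == iB | k == iT] by case: k => [[|[|[|]]]].
by case/or3P => /eqP ->.
Qed.

Lemma kills1_part tau w s : kills1 w -> size tau = size s -> (0 < count_mem iZ tau)%N ->
  w (project_seq P tau s) = 0.
Proof.
elim: s tau w => [|X s IH] [|k tau]//= w wk [st].
case: eqP => [->|_] tk; first exact: (wk [::]).
apply: (IH tau (int_mult (P k X) w)) => // s1 Y s2.
exact: (wk (P k X :: s1)).
Qed.

Lemma kills2_part tau w s : kills2 w -> size tau = size s -> (1 < count_mem iZ tau)%N ->
  w (project_seq P tau s) = 0.
Proof.
elim: s tau w => [|X s IH] [|k tau]//= w wk [st].
case: eqP => [->|_] tk.
  apply: (@kills1_part tau (int_mult (P iZ X) w)) => // s1 Y s2.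
  exact: (wk [::] X s1).
apply: (IH tau (int_mult (P k X) w)) => // s1 Y s2 Z s3.
exact: (wk (P k X :: s1)).
Qed.

Lemma bracketDl X Y Z : bracket (X + Y) Z = bracket X Z + bracket Y Z.
Proof.
rewrite /graded_bracket -big_split; apply: eq_bigr => k _ /=.
rewrite -big_split; apply: eq_bigr => j _ /=.
by rewrite -big_split; apply: eq_bigr => l _ /=; rewrite PD brDl PD.
Qed.

Lemma projN k X : P k (- X) = - P k X.
Proof.
apply/eqP; rewrite -addr_eq0 -PD addNr; apply/eqP.
by apply: (addIr (P k 0)); rewrite -PD !add0r.
Qed.

Lemma bracketC X Y : bracket X Y = - bracket Y X.
Proof.
rewrite /graded_bracket exchange_big -sumrN; apply: eq_bigr => k _ /=.
rewrite -sumrN; apply: eq_bigr => j _ /=; rewrite -sumrN.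
apply: eq_big => [l|l _]; last by rewrite brC projN.
by rewrite perm_sym (perm_eql_swap j k [::]) perm_sym.
Qed.

Lemma bracketDr X : {morph bracket X : Y Z / Y + Z}.
Proof. by move=> Y Z; rewrite bracketC bracketDl opprD -!bracketC. Qed.

Lemma actDl X Y f : act (X + Y) f = act X f + act Y f.
Proof. by rewrite /graded_act PD aDl. Qed.

Lemma actDr X : {morph act X : f g / f + g}.
Proof. by move=> f g; exact: aDr. Qed.

Lemma alternating_sum_part i p q w : aform w ->
  alternating_sum a br (part P (has_type i p q) w) =
  exterior a br (part P (has_type i p q) w).
Proof.
move=> [_ wC]; apply/funext => s; apply: alternating_sumE.
  exact: actNr.
apply: skew_part => // t1 k l t2; rewrite /has_type !count_cat /=.
by congr [&& _, _ & _]; congr (_ == _); congr (_ + _)%N; exact: addnCA.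
Qed.

(* On arguments of pure types [tau], the terms of [d] that survive the projection
   of [d'] are exactly those of the exterior differential built from the anchor
   [act] and the bracket [bracket]. *)
Lemma dprimeE w s : aform w -> kills2 w ->
  dprime_sum w s = exterior act bracket w s.
Proof.
move=> wF wk; have [wD wC] := wF; set n := size s.
pose F (tau : n.-tuple 'I_3) := exterior act bracket w (project_seq P tau s).
have sz (tau : n.-tuple 'I_3) : size tau = size s by rewrite size_tuple.
have FE (tau : n.-tuple 'I_3) :
    exterior a br (part P (one_b_less iB tau) w) (project_seq P tau s) = F tau.
  exact: exterior_part.
rewrite -(sum_project_seq P_sum s
  (multiadditive_exterior actDl actDr bracketDl bracketDr wD)).
transitivity (\sum_(i < 2) \sum_(p < n) \sum_(q < n)
    \sum_(tau : n.-tuple 'I_3) if has_type i p.+1 q tau then F tau else 0).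
  rewrite /dprime_sum; do 3!apply: eq_bigr => ? _.
  rewrite alternating_sum_part// -big_mkcond; apply: eq_bigr => tau ht.
  rewrite -FE; congr exterior; apply/funext => t; apply: eq_part => t'.
  move: ht; rewrite /has_type /one_b_less perm_eq_types /= => /and3P[/eqP -> /eqP -> /eqP ->].
  by rewrite add0n add1n eqSS.
have exch (I J : finType) (G : I -> J -> W) :
  \sum_i \sum_j G i j = \sum_j \sum_i G i j by exact: exchange_big.
(* The sum over words becomes the outermost one, so that each word can be matched with the triples
   [(i, p, q)] that select it. *)
under eq_bigr do (under eq_bigr do rewrite exch; rewrite exch).
rewrite exch.
apply: eq_bigr => tau _; rewrite -[RHS]/(F tau).
(* A word with two [iZ], or with no [iB], is selected by no triple, and [F tau] vanishes. Any other
   word is selected by exactly one. *)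
have [tZ|tZ] := ltnP (count_mem iZ tau) 2; last first.
  have -> : F tau = 0.
    rewrite -FE (_ : part _ _ _ = 0) ?exterior0//.
    apply/funext => t; rewrite /part big1// => t'.
    rewrite /one_b_less perm_eq_types /= => /and3P[/eqP E _ _].
    by apply: kills2_part => //; rewrite ?size_tuple// -E in tZ *.
  by rewrite big1// => i _; rewrite big1// => p _; rewrite big1// => q _; case: ifP.
have [tB|tB] := posnP (count_mem iB tau).
  have -> : F tau = 0.
    rewrite -FE (_ : part _ _ _ = 0) ?exterior0//.
    apply/funext => t; apply: part_pred0 => t'.
    rewrite /one_b_less perm_eq_types /= tB add1n eqE /= andbF.
    by [].
  by rewrite big1// => i _; rewrite big1// => p _; rewrite big1// => q _; case: ifP.
have cnt := count_types tau; rewrite size_tuple in cnt.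
(* The selecting triple lies within the bounds of the sums because one of the [n] entries is an
   [iB]. *)
have tBn : ((count_mem iB tau).-1 < n)%N.
  rewrite prednK//; apply: leq_trans (leq_addr (count_mem iT tau) _) _.
  by rewrite -[leqRHS]cnt leq_addl.
have tTn : (count_mem iT tau < n)%N.
  by rewrite -[ltnRHS]cnt addnA -[ltnLHS]add0n ltn_add2r addn_gt0 tB orbT.
rewrite (bigD1 (Ordinal tZ))//= (bigD1 (Ordinal tBn))//= (bigD1 (Ordinal tTn))//=.
rewrite {1}/has_type prednK// !eqxx /=.
rewrite big1 => [|q qT]; last first.
  case: ifP => // /and3P[_ _ /eqP E]; case/eqP: qT.
  by apply: val_inj; rewrite /= -E.
rewrite [X in _ + _ + X + _]big1 => [|p pB]; last first.
  rewrite big1// => q _; case: ifP => // /and3P[_ /eqP E _]; case/eqP: pB.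
  by apply: val_inj; rewrite /= E.
rewrite big1 ?addr0// => i iZ'.
rewrite big1// => p _; rewrite big1// => q _.
case: ifP => // /and3P[/eqP E _ _]; case/eqP: iZ'.
by apply: val_inj; rewrite /= E.
Qed.

(** If one of the two types is [iB], the condition on [l] in [graded_bracket] forces [l] to be the
    other type. *)
Lemma bracket_PBr X Z : bracket X (P iB Z) =
  \sum_k P k (br (P k X) (P iB Z)).
Proof.
have E k : bracket (P k X) (P iB Z) = P k (br (P k X) (P iB Z)).
  rewrite (graded_bracket_PP PD PP iB brDl brDr) (bigD1 k) /=; last first.
    by rewrite (perm_eql_swap iB k [::]).
  rewrite big1 ?addr0// => l /andP[+ /negP lk].
  rewrite perm_sym (perm_eql_swap k iB [::]) perm_cons => /perm_mem/(_ l).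
  by rewrite !inE eqxx.
rewrite -{1}(P_sum X) -(eq_bigr _ (fun k _ => E k)).
apply: (big_morph (fun X => bracket X (P iB Z))) => [Y Y'|]; first exact: bracketDl.
by apply: (addIr (bracket 0 (P iB Z))); rewrite -bracketDl !add0r.
Qed.

Section contractions.
Variables phi psi : seq V -> V.
Local Notation phi1 X := (phi [:: X]).
Local Notation psi1 X := (psi [:: X]).
Hypothesis phiD : {morph (fun X => phi1 X) : X Y / X + Y}.
Hypothesis psiD : {morph (fun X => psi1 X) : X Y / X + Y}.
Hypothesis phi_val : forall X, P iB (phi1 X) = phi1 X.
Hypothesis psi_val : forall X, P iB (psi1 X) = psi1 X.
Hypothesis phi_arg : forall k X, k != iT -> phi1 (P k X) = 0.
Hypothesis psi_arg : forall k X, k != iT -> psi1 (P k X) = 0.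
Hypothesis brBB : forall X Y,
  P iB (br (P iB X) (P iB Y)) = br (P iB X) (P iB Y).

Definition bracket_form s : V := if s is [:: X0; Y0] then
    let X := P iT X0 in let Y := P iT Y0 in
    br (phi1 X) (psi1 Y) + br (psi1 X) (phi1 Y)
     - phi1 (P iT (br X (psi1 Y)) + P iT (br (psi1 X) Y))
     - psi1 (P iT (br (phi1 X) Y) + P iT (br X (phi1 Y)))
  else 0.

Lemma arg_sum (f : V -> V) (F : 'I_3 -> V) : {morph f : X Y / X + Y} ->
  (forall k X, k != iT -> f (P k X) = 0) ->
  f (\sum_k P k (F k)) = f (P iT (F iT)).
Proof.
move=> fD f0; rewrite (bigD1 iT)//= fD.
suff -> : f (\sum_(k | k != iT) P k (F k)) = 0 by rewrite addr0.
elim/big_rec: _ => [|k X kT fX]; first by apply: (addIr (f 0)); rewrite -fD !add0r.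
by rewrite fD fX addr0 f0.
Qed.

Lemma arg_T (f : V -> V) X : {morph f : X Y / X + Y} ->
  (forall k X, k != iT -> f (P k X) = 0) -> f (P iT X) = f X.
Proof. by move=> fD f0; rewrite -{2}(P_sum X) (arg_sum (fun=> X)). Qed.

(** Every bracket involved has an argument in the [iB] summand, so [bracket_PBr] applies. If both
    arguments lie there, integrability gives [br] itself; otherwise [phi] and [psi] see only the
    [iT] component of the result. *)
Lemma bracket_formE X Y : bracket_form [:: X; Y] =
  nijenhuis bracket (fun X => phi1 X) (fun X => psi1 X) X Y.
Proof.
rewrite /bracket_form /nijenhuis /=.
have T f := @arg_T f; rewrite !(T _ _ phiD phi_arg) !(T _ _ psiD psi_arg).
have BB X' Y' : bracket (P iB X') (P iB Y') = br (P iB X') (P iB Y').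
  rewrite bracket_PBr (bigD1 iB)//= PP eqxx brBB big1 ?addr0// => k kB.
  rewrite PP (negbTE kB); have -> : br 0 (P iB Y') = 0.
    by apply: (addIr (br 0 (P iB Y'))); rewrite -brDl !add0r.
  by apply: (addIr (P k 0)); rewrite -PD !add0r.
have BR (f : V -> V) X' Z : {morph f : X Y / X + Y} ->
    (forall k X, k != iT -> f (P k X) = 0) ->
    f (bracket X' (P iB Z)) = f (P iT (br (P iT X') (P iB Z))).
  move=> fD f0; rewrite bracket_PBr.
  exact: (arg_sum (fun k => br (P k X') (P iB Z)) fD f0).
have fN (f : V -> V) X' : {morph f : X Y / X + Y} -> f (- X') = - f X'.
  move=> fD; apply/eqP; rewrite -addr_eq0 -fD addNr; apply/eqP.
  by apply: (addIr (f 0)); rewrite -fD !add0r.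
have BL (f : V -> V) X' Z : {morph f : X Y / X + Y} ->
    (forall k X, k != iT -> f (P k X) = 0) ->
    f (bracket (P iB Z) X') = f (P iT (br (P iB Z) (P iT X'))).
  by move=> fD f0; rewrite bracketC brC projN !fN// BR.
rewrite !phiD !psiD -[phi1 X]phi_val -[phi1 Y]phi_val -[psi1 X]psi_val -[psi1 Y]psi_val.
rewrite !BB !(BR (fun X => phi1 X))// !(BL (fun X => phi1 X))//.
by rewrite !(BR (fun X => psi1 X))// !(BL (fun X => psi1 X))//.
Qed.

Lemma kills1_ext (f : V -> V) w : (forall X, f (P iZ X) = 0) ->
  multiadditive w -> kills1 w -> kills1 (derivation_ext f w).
Proof.
move=> f0 + + s1; elim: s1 w => [|Z s1 IH] w wD wk X s2 /=.
  rewrite f0 form_head0// add0r [int_mult _ _](_ : _ = 0) ?derivation_ext_eq0//.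
  by apply/funext => s; exact: (wk [::]).
rewrite (wk (f Z :: s1)) add0r; apply: IH; first exact: multiadditive_int.
by move=> t1 Y t2; exact: (wk (Z :: t1)).
Qed.

Lemma kills2_ext (f : V -> V) w : (forall X, f (P iZ X) = 0) ->
  multiadditive w -> kills2 w -> kills2 (derivation_ext f w).
Proof.
move=> f0 + + s1; elim: s1 w => [|Z s1 IH] w wD wk X s2 Y s3 /=.
  rewrite f0 form_head0// add0r; apply: kills1_ext => //.
    exact: multiadditive_int.
  by move=> t1 X' t2; exact: (wk [::] X t1).
rewrite (wk (f Z :: s1)) add0r; apply: IH; first exact: multiadditive_int.
by move=> t1 X' t2 Y' t3; exact: (wk (Z :: t1)).
Qed.

Theorem contraction_bracket w s : aform w -> kills2 w ->
  contraction 2 bracket_form w s =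
  contraction 1 phi (dprime_sum (contraction 1 psi w)) s
  + contraction 1 psi (dprime_sum (contraction 1 phi w)) s
  - dprime_sum (contraction 1 psi (contraction 1 phi w)) s
  - contraction 1 psi (contraction 1 phi (dprime_sum w)) s.
Proof.
move=> wF wk; have [wD wC] := wF.
have C (f : seq V -> V) (u : seq V -> W) : aform u ->
    contraction 1 f u = derivation_ext (fun X => f [:: X]) u.
  by move=> [_ uC]; apply/funext => t; exact: contraction1.
have D u : aform u -> kills2 u -> dprime_sum u = exterior act bracket u.
  by move=> uF uk; apply/funext => t; exact: dprimeE.
have dF u : aform u -> aform (exterior act bracket u).
  by move=> uF; apply: (aform_exterior actDl actDr bracketDl bracketDr bracketC).
have iF (f : V -> V) (u : seq V -> W) : {morph f : X Y / X + Y} ->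
    aform u -> aform (derivation_ext f u).
  by move=> fD; exact: aform_ext.
have phiZ X : phi1 (P iZ X) = 0 by exact: phi_arg.
have psiZ X : psi1 (P iZ X) = 0 by exact: psi_arg.
have phiF := iF _ _ phiD wF; have psiF := iF _ _ psiD wF.
have ppF := iF _ _ psiD phiF.
have [phiw _] := phiF.
have phik := kills2_ext (f := fun X => phi1 X) phiZ wD wk.
have psik := kills2_ext (f := fun X => psi1 X) psiZ wD wk.
have ppk := kills2_ext (f := fun X => psi1 X) psiZ phiw phik.
rewrite contraction2// (C phi w wF) (C psi w wF) (C psi _ phiF).
rewrite (D w wF wk) (D _ psiF psik) (D _ phiF phik) (D _ ppF ppk).
rewrite (C phi _ (dF _ psiF)) (C psi _ (dF _ phiF)) (C phi _ (dF _ wF)).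
rewrite (C psi _ (iF _ _ phiD (dF _ wF))).
have phipsi X : phi1 (psi1 X) = 0 by rewrite -psi_val phi_arg.
have psiphi X : psi1 (phi1 X) = 0 by rewrite -phi_val psi_arg.
rewrite -(nijenhuis_commutator actDl actDr bracketDl bracketDr phiD psiD phipsi psiphi)//.
congr ext2; apply/funext => X; apply/funext => Y; exact: bracket_formE.
Qed.

End contractions.
End bigraded.

(** * Smooth fields and functions as modules *)

Section smooth_subtypes.
Variables (R : realType) (m : nat) (M : manifold R m).
Local Notation C := R[i].

(** Forms are constrained on smooth fields only, whereas [multiadditive] and [skew] quantify over
    all arguments; the subtypes reconcile the two. *)
Record sfield := SField {
  sfield_val :> vector_field M; _ : `[< smooth_field setT sfield_val >] }.

HB.instance Definition _ := [isSub for sfield_val].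
HB.instance Definition _ := [Choice of sfield by <:].

Definition sfield0_subproof : `[< smooth_field setT (0 : vector_field M) >] :=
  asboolT (@smooth_field0 R m M).

(* The operations on these subtypes are hidden behind opaque constants, as
   unification would otherwise unfold them down to the real numbers. *)
Fact mk_field_key : {mk : vector_field M -> sfield |
  forall X, smooth_field setT X -> sfield_val (mk X) = X}.
Proof.
exists (insubd (SField sfield0_subproof)) => X Xs.
by rewrite [LHS]insubdK//; exact/asboolP.
Qed.

Definition mk_field := sval mk_field_key.

Lemma mk_fieldK X : smooth_field setT X -> sfield_val (mk_field X) = X.
Proof. exact: (svalP mk_field_key). Qed.

Record sfun := SFun {
  sfun_val :> M -> C; _ : `[< smooth_fun setT sfun_val >] }.

HB.instance Definition _ := [isSub for sfun_val].
HB.instance Definition _ := [Choice of sfun by <:].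

Definition sfun0_subproof : `[< smooth_fun setT ((fun=> 0) : M -> C) >] :=
  asboolT (@smooth_fun_cst R m M setT 0).

Fact mk_fun_key : {mk : (M -> C) -> sfun |
  forall f, smooth_fun setT f -> sfun_val (mk f) = f}.
Proof.
exists (insubd (SFun sfun0_subproof)) => f fs.
by rewrite [LHS]insubdK//; exact/asboolP.
Qed.

Definition mk_fun := sval mk_fun_key.

Lemma mk_funK f : smooth_fun setT f -> sfun_val (mk_fun f) = f.
Proof. exact: (svalP mk_fun_key). Qed.

Lemma sfieldP (X : sfield) : smooth_field setT X.
Proof. by case: X => X /= /asboolP. Qed.

Lemma sfunP (f : sfun) : smooth_fun setT f.
Proof. by case: f => f /= /asboolP. Qed.

Fact sfield_zero_key : {op : sfield |
  sfield_val op = 0}.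
Proof.
by exists (mk_field 0); apply: mk_fieldK; exact: smooth_field0.
Qed.

Definition sfield_zero := sval sfield_zero_key.
Fact sfield_opp_key : {op : sfield -> sfield |
  forall X, sfield_val (op X) = - sfield_val X}.
Proof.
exists (fun X => mk_field (- sfield_val X)) => X.
by apply: mk_fieldK; apply: smooth_fieldN; exact: sfieldP.
Qed.

Definition sfield_opp := sval sfield_opp_key.
Fact sfield_add_key : {op : sfield -> sfield -> sfield |
  forall X Y, sfield_val (op X Y) = sfield_val X + sfield_val Y}.
Proof.
exists (fun X Y => mk_field (sfield_val X + sfield_val Y)) => X Y.
by apply: mk_fieldK; apply: smooth_fieldD; exact: sfieldP.
Qed.

Definition sfield_add := sval sfield_add_key.

Lemma sfield_addE X Y :
  sfield_val (sfield_add X Y) = sfield_val X + sfield_val Y.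
Proof. exact: (svalP sfield_add_key). Qed.

Lemma sfield_oppE X : sfield_val (sfield_opp X) = - sfield_val X.
Proof. exact: (svalP sfield_opp_key). Qed.

Lemma sfield_zeroE : sfield_val sfield_zero = 0.
Proof. exact: (svalP sfield_zero_key). Qed.

Lemma sfield_addA : associative sfield_add.
Proof. by move=> X Y Z; apply: val_inj; rewrite /= !sfield_addE addrA. Qed.

Lemma sfield_addC : commutative sfield_add.
Proof. by move=> X Y; apply: val_inj; rewrite /= !sfield_addE addrC. Qed.

Lemma sfield_add0 : left_id sfield_zero sfield_add.
Proof. by move=> X; apply: val_inj; rewrite /= sfield_addE sfield_zeroE add0r. Qed.

Lemma sfield_addN : left_inverse sfield_zero sfield_opp sfield_add.
Proof.
by move=> X; apply: val_inj; rewrite /= sfield_addE sfield_zeroE sfield_oppE addNr.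
Qed.

HB.instance Definition _ := GRing.isZmodule.Build sfield
  sfield_addA sfield_addC sfield_add0 sfield_addN.

Fact sfun_zero_key : {op : sfun |
  sfun_val op = 0}.
Proof.
by exists (mk_fun 0); apply: mk_funK; exact: smooth_fun_cst.
Qed.

Definition sfun_zero := sval sfun_zero_key.
Fact sfun_opp_key : {op : sfun -> sfun |
  forall f, sfun_val (op f) = - sfun_val f}.
Proof.
exists (fun f => mk_fun (- sfun_val f)) => f.
by apply: mk_funK; apply: smooth_funN; [exact: openT|exact: sfunP].
Qed.

Definition sfun_opp := sval sfun_opp_key.
Fact sfun_add_key : {op : sfun -> sfun -> sfun |
  forall f g, sfun_val (op f g) = sfun_val f + sfun_val g}.
Proof.
exists (fun f g => mk_fun (sfun_val f + sfun_val g)) => f g.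
by apply: mk_funK; apply: smooth_funD; [exact: openT|exact: sfunP..].
Qed.

Definition sfun_add := sval sfun_add_key.

Lemma sfun_addE f g :
  sfun_val (sfun_add f g) = sfun_val f + sfun_val g.
Proof. exact: (svalP sfun_add_key). Qed.

Lemma sfun_oppE f : sfun_val (sfun_opp f) = - sfun_val f.
Proof. exact: (svalP sfun_opp_key). Qed.

Lemma sfun_zeroE : sfun_val sfun_zero = 0.
Proof. exact: (svalP sfun_zero_key). Qed.

Lemma sfun_addA : associative sfun_add.
Proof. by move=> f g h; apply: val_inj; rewrite /= !sfun_addE addrA. Qed.

Lemma sfun_addC : commutative sfun_add.
Proof. by move=> f g; apply: val_inj; rewrite /= !sfun_addE addrC. Qed.

Lemma sfun_add0 : left_id sfun_zero sfun_add.
Proof. by move=> f; apply: val_inj; rewrite /= sfun_addE sfun_zeroE add0r. Qed.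

Lemma sfun_addN : left_inverse sfun_zero sfun_opp sfun_add.
Proof.
by move=> f; apply: val_inj; rewrite /= sfun_addE sfun_zeroE sfun_oppE addNr.
Qed.

HB.instance Definition _ := GRing.isZmodule.Build sfun
  sfun_addA sfun_addC sfun_add0 sfun_addN.

Lemma sfieldD (X Y : sfield) : sfield_val (X + Y) = sfield_val X + sfield_val Y.
Proof. exact: sfield_addE. Qed.

Lemma sfield0 : sfield_val 0 = 0.
Proof. exact: sfield_zeroE. Qed.

Lemma sfieldN (X : sfield) : sfield_val (- X) = - sfield_val X.
Proof. exact: sfield_oppE. Qed.

Lemma sfield_sum (I : Type) (r : seq I) (P : pred I) (F : I -> sfield) :
  sfield_val (\sum_(i <- r | P i) F i) = \sum_(i <- r | P i) sfield_val (F i).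
Proof. by apply: (big_morph _ sfieldD sfield0). Qed.

Lemma sfunD (f g : sfun) : sfun_val (f + g) = sfun_val f + sfun_val g.
Proof. exact: sfun_addE. Qed.

Lemma sfun0 : sfun_val 0 = 0.
Proof. exact: sfun_zeroE. Qed.

Lemma sfunN (f : sfun) : sfun_val (- f) = - sfun_val f.
Proof. exact: sfun_oppE. Qed.

Lemma sfun_sum (I : Type) (r : seq I) (P : pred I) (F : I -> sfun) :
  sfun_val (\sum_(i <- r | P i) F i) = \sum_(i <- r | P i) sfun_val (F i).
Proof. by apply: (big_morph _ sfunD sfun0). Qed.

Lemma sfun_signed n (f : sfun) :
  sfun_val (signed n f) = (-1) ^+ n *: (sfun_val f : M -> C^o).
Proof.
rewrite /signed -signr_odd; case: (odd n); last by rewrite expr0 scale1r.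
by rewrite expr1 scaleN1r sfunN.
Qed.

End smooth_subtypes.

(** * Passage between forms and their restrictions to smooth fields *)

Section transport.
Variables (R : realType) (m : nat) (M : manifold R m).
Variables (T0 : subspaces M) (zeta : vector_field M).
Local Notation C := R[i].
Local Notation V := (sfield M).
Local Notation W := (sfun M).
Local Notation fields := (map (@sfield_val R m M)).
Hypothesis smooth_proj : forall k X, smooth_field setT X ->
  smooth_field setT (project T0 zeta k X).
Implicit Types (w : diff_form M) (z : seq V -> W) (s : seq V).
Implicit Types (u : vform M) (v : seq V -> V).

(** Being a relation, it passes through composites of operators, each of which only has to preserve
    it. *)
Definition lifts w z := forall s, w (fields s) = z s.

Definition vlifts u v := forall s, u (fields s) = v s.

Fact sproject_key : {op : 'I_3 -> V -> V | forall k (X : V),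
  smooth_field setT (project T0 zeta k X) ->
  op k X = project T0 zeta k X :> vector_field M}.
Proof. by exists (fun k X => mk_field (project T0 zeta k X)) => k X; exact: mk_fieldK. Qed.

Definition sproject := sval sproject_key.

Lemma sprojectE k X : sproject k X = project T0 zeta k X :> vector_field M.
Proof. by apply: (svalP sproject_key); apply: smooth_proj; exact: sfieldP. Qed.

Fact sact_key : {op : V -> W -> W | forall (X : V) (f : W), op X f = vact X f :> (M -> C)}.
Proof.
exists (fun X f => mk_fun (vact X f)) => X f.
by apply: mk_funK; apply: sfieldP => //; [exact: openT|exact: sfunP].
Qed.

Definition sact := sval sact_key.

Lemma sactE X f : sact X f = vact X f :> (M -> C).
Proof. exact: (svalP sact_key). Qed.

Fact slie_key : {op : V -> V -> V |
  forall X Y : V, op X Y = lie_bracket X Y :> vector_field M}.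
Proof.
exists (fun X Y => mk_field (lie_bracket X Y)) => X Y.
by apply: mk_fieldK; apply: smooth_lie; [exact: openT|exact: sfieldP..].
Qed.

Definition slie := sval slie_key.

Lemma slieE X Y : slie X Y = lie_bracket X Y :> vector_field M.
Proof. exact: (svalP slie_key). Qed.

Lemma smooth_fields_seq (s : seq (vector_field M)) : smooth_fields s ->
  fields (map (@mk_field _ _ _) s) = s.
Proof.
elim: s => //= X s IH /smooth_fields_cons[Xs ss].
by rewrite mk_fieldK// IH.
Qed.

Lemma smooth_fields_fields s : smooth_fields (fields s).
Proof.
elim: s => [|X s IH]; first by move=> [].
by apply/smooth_fields_cons; split=> //; exact: sfieldP.
Qed.

Lemma lifts_form w :
  (forall t : seq (vector_field M), smooth_fields t -> smooth_fun setT (w t)) ->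
  lifts w (fun s => mk_fun (w (fields s))).
Proof. by move=> ws s; rewrite mk_funK//; apply: ws; exact: smooth_fields_fields. Qed.

Lemma lifts_contraction q u v w z : vlifts u v -> lifts w z ->
  lifts (contract_form q u w) (contraction q v z).
Proof.
move=> uu ww s; rewrite /contract_form /shuffle_sum /contraction /shuffles.
rewrite sfun_sum size_map; apply: eq_bigr => b _.
rewrite sfun_signed -!map_mask uu -ww.
by [].
Qed.

Lemma fields_delete i s : Defs.drop_nth i (fields s) = fields (delete i s).
Proof. by rewrite /Defs.drop_nth /delete map_cat map_take map_drop. Qed.

Lemma fields_nth i s : (fields s)`_i = sfield_val s`_i.
Proof.
have [si|si] := ltnP i (size s); first by rewrite (nth_map 0).
by rewrite !nth_default ?size_map// sfield0.
Qed.

Lemma lifts_alternating_sum w z : lifts w z ->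
  lifts (dform w) (alternating_sum sact slie z).
Proof.
move=> ww s; rewrite /dform /alternating_sum size_map sfunD !sfun_sum.
congr (_ + _).
  apply: eq_bigr => i _.
  by rewrite sfun_signed sactE -ww fields_nth fields_delete.
apply: eq_bigr => i _; rewrite sfun_sum; apply: eq_bigr => j _.
by rewrite sfun_signed -ww /= slieE !fields_nth !fields_delete.
Qed.

Lemma lifts_component i p q w z : lifts w z ->
  lifts (component T0 zeta i p q w) (part sproject (has_type i p q) z).
Proof.
move=> ww s; rewrite /component /part size_map sfun_sum.
(* Type assignments are finite functions on positions in [component] and words in [part]. *)
rewrite (reindex (fun tau : (size s).-tuple 'I_3 => [ffun j => tnth tau j])) /=.
  apply: eq_big => [tau|tau _].
    have cnt k : #|[pred j | [ffun j => tnth tau j] j == k]| = count_mem k tau.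
      rewrite -sum1_card -sum1_count big_tuple; apply: eq_bigl => j.
      by rewrite inE ffunE.
    by rewrite /has_type !cnt.
  rewrite -ww; congr w.
  apply: (@eq_from_nth _ 0).
    by rewrite [LHS]size_map size_enum_ord !size_map size_zip size_tuple minnn.
  move=> j; rewrite [X in (_ < X)%N]size_map size_enum_ord => js.
  rewrite (nth_map (Ordinal js)) ?size_enum_ord//.
  rewrite !fields_nth /project_seq (nth_map (iZ, 0)) ?size_zip ?size_tuple ?minnn//.
  rewrite nth_zip ?size_tuple//= sprojectE ffunE.
  rewrite (nth_ord_enum (Ordinal js) (Ordinal js)).
  by rewrite (tnth_nth iZ).
exists (fun t => [tuple t j | j < size s]) => [tau _|t _].
  by apply: eq_from_tnth => j; rewrite tnth_mktuple ffunE.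
by apply/ffunP => j; rewrite ffunE tnth_mktuple.
Qed.

Lemma lifts_dprime w z : lifts w z ->
  lifts (dprime T0 zeta w) (dprime_sum sproject sact slie z).
Proof.
move=> ww s; rewrite /dprime /dprime_sum sfun_sum; apply: eq_bigr => i _.
rewrite size_map sfun_sum; apply: eq_bigr => p _.
rewrite sfun_sum; apply: eq_bigr => q _.
by apply: lifts_component; apply: lifts_alternating_sum; exact: lifts_component.
Qed.

End transport.

(** * Forms on a CR manifold *)

Section cr_forms.
Variables (R : realType) (n m : nat) (M : manifold R m).
Variables (T0 : subspaces M) (zeta : vector_field M).
Local Notation C := R[i].
Local Notation V := (sfield M).
Local Notation W := (sfun M).
Local Notation fields := (map (@sfield_val R m M)).
Hypothesis m_eq : m = (n.-1 + (n.-1 + 1))%N.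
Hypothesis T0_bundle : subbundle n.-1 T0.
Hypothesis T0_conj : forall p, (T0 p :&: conj_subspaces T0 p)%MS = 0.
Hypothesis T0_lie : forall U (X Y : vector_field M), open U ->
  section_over U T0 X -> section_over U T0 Y ->
  section_over U T0 (lie_bracket X Y).
Hypothesis zeta_smooth : smooth_field setT zeta.
Hypothesis zeta_transversal :
  forall p, ~~ (zeta p <= T0 p + conj_subspaces T0 p)%MS.

Local Notation sm_proj :=
  (smooth_project m_eq T0_bundle T0_conj zeta_smooth zeta_transversal).
Local Notation SP := (sproject T0 zeta).
Local Notation SPE := (sprojectE sm_proj).

Lemma sfield_inj (X Y : V) : X = Y :> vector_field M -> X = Y.
Proof. exact: val_inj. Qed.

Lemma sprojectD k : {morph SP k : X Y / X + Y}.
Proof.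
by move=> X Y; apply: sfield_inj; rewrite sfieldD !SPE sfieldD projectD.
Qed.

Lemma sproject_sum X : \sum_k SP k X = X.
Proof.
apply: sfield_inj; rewrite sfield_sum.
under eq_bigr do rewrite SPE.
exact: (project_sum m_eq T0_bundle T0_conj zeta_transversal).
Qed.

Lemma sprojectP k l X : SP k (SP l X) = if k == l then SP l X else 0.
Proof.
apply: sfield_inj; rewrite SPE; case: eqP => [->|/eqP kl].
  apply/funext => p; rewrite (project_id m_eq T0_bundle T0_conj zeta_transversal)//.
  by rewrite SPE; exact: project_sub.
rewrite sfield0; apply/funext => p.
rewrite (project_0 m_eq T0_bundle T0_conj zeta_transversal _ kl)//.
by rewrite SPE; exact: project_sub.
Qed.

Lemma sfun_inj (f g : W) : f = g :> (M -> C) -> f = g.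
Proof. exact: val_inj. Qed.

Lemma sactDl X Y (f : W) : sact (X + Y) f = sact X f + sact Y f.
Proof. by apply: sfun_inj; rewrite sfunD !sactE sfieldD vactDl. Qed.

Lemma sactDr (X : V) : {morph @sact R m M X : f g / f + g}.
Proof.
move=> f g; apply: sfun_inj; rewrite sfunD !sactE sfunD; apply/funext => p.
have sI (h : W) : cdiff_at h p.
  have pT : [set: M] p by [].
  exact: (smooth_cdiff_at (sfunP h) pT).
exact: vactD (sI f) (sI g).
Qed.

Lemma slieDl (X Y Z : V) : slie (X + Y) Z = slie X Z + slie Y Z.
Proof.
by apply: sfield_inj; rewrite sfieldD !slieE sfieldD (lieDl _ (sfieldP X) (sfieldP Y)).
Qed.

Lemma slieDr (X : V) : {morph @slie R m M X : Y Z / Y + Z}.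
Proof.
by move=> Y Z; apply: sfield_inj; rewrite sfieldD !slieE sfieldD (lieDr _ (sfieldP Y) (sfieldP Z)).
Qed.

Lemma slieC (X Y : V) : slie X Y = - slie Y X.
Proof. by apply: sfield_inj; rewrite sfieldN !slieE lieC. Qed.

Lemma lie_conj_T0 (X Y : vector_field M) :
  section_over setT (conj_subspaces T0) X ->
  section_over setT (conj_subspaces T0) Y ->
  section_over setT (conj_subspaces T0) (lie_bracket X Y).
Proof.
have conjT0 (Z : vector_field M) : section_over setT (conj_subspaces T0) Z ->
    section_over setT T0 (conj_field Z).
  move=> [Zs ZT]; split=> [|p _]; first exact: smooth_field_conj.
  have := ZT p I; rewrite -(map_submx (@conjc R)) /conj_subspaces.
  rewrite [X in (_ <= X)%MS](_ : _ = T0 p)//.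
  apply/matrixP => i j; rewrite !mxE; exact: conjc_conjc.
move=> XT YT; have [Xs _] := XT; have [Ys _] := YT.
have [_ LT] := T0_lie openT (conjT0 _ XT) (conjT0 _ YT).
split=> [|p _]; first exact: smooth_lie openT Xs Ys.
have := LT p I; rewrite lie_conj// -(map_submx (@conjc R)).
by rewrite -[map_mx _ (conj_field _ p)]/(conj_field (conj_field (lie_bracket X Y)) p) conj_fieldK.
Qed.

Lemma slieBB (X Y : V) :
  SP iB (slie (SP iB X) (SP iB Y)) = slie (SP iB X) (SP iB Y).
Proof.
have PB Z : section_over setT (conj_subspaces T0) (SP iB Z).
  by split=> [|p _]; [exact: sfieldP|rewrite SPE; exact: project_sub].
apply: sfield_inj; rewrite SPE slieE; apply/funext => p.
rewrite (project_id m_eq T0_bundle T0_conj zeta_transversal)//.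
by have [_] := lie_conj_T0 (PB X) (PB Y); exact.
Qed.

(** The coefficient is chosen pointwise. Locally it is a quotient of the actions of two smooth
    fields on a coordinate along which [zeta] does not vanish, hence smooth. *)
Lemma zeta_coefficient (X : V) : exists2 f : M -> C, smooth_fun setT f &
  SP iZ X = fscale f zeta :> vector_field M.
Proof.
have /choice[f fE] : forall p, exists a : C, sfield_val (SP iZ X) p = a *: zeta p.
  move=> p; apply/sub_rVP; have := project_sub T0 zeta iZ X p.
  by rewrite SPE /= genmxE.
exists f; last by apply/funext => p; rewrite fE.
apply: smooth_fun_local => p _.
have [j zj] : exists j, zeta p 0 j != 0.
  apply/existsP; apply: contraR (zeta_transversal p) => /existsPn z0.
  rewrite (_ : zeta p = 0) ?sub0mx//; apply/rowP => j.
  by have := z0 j; rewrite negbK mxE => /eqP.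
have Do := @open_chart_dom _ _ M p.
have cs (Z : vector_field M) : smooth_field setT Z ->
    smooth_fun (chart_dom (chart_at p)) (vact Z (Defs.coord p j)).
  by move=> Zs; apply: Zs => //; exact: smooth_coord.
have zs := cs _ zeta_smooth.
have No := open_cneq0 Do zs.
set N := [set q | _ /\ _] in No.
exists N; split=> //.
  by split; [exact: chart_domP|rewrite vact_coord].
have ND : N `<=` chart_dom (chart_at p) by move=> q [].
have zV : smooth_fun N (fun q => (vact zeta (Defs.coord p j) q)^-1).
  by apply: smooth_funV => //; [move=> q []|exact: sub_smooth_fun ND zs].
apply: eq_smooth_fun (smooth_funM No (sub_smooth_fun ND (cs _ (sfieldP (SP iZ X)))) zV) => //.
move=> q [_ zq].
have -> : vact (SP iZ X) (Defs.coord p j) q = vact (fscale f zeta) (Defs.coord p j) q.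
  by apply: eq_vact_at; rewrite fE.
by rewrite vact_scalel mulfK.
Qed.

Lemma fscale1 (L : lmodType C) (X : M -> L) : fscale (fun=> 1) X = X.
Proof. by apply/funext => p; rewrite /fscale scale1r. Qed.

Lemma alternatingD (L : lmodType C) (u : seq (vector_field M) -> M -> L) s1 X Y s2 :
  Defs.alternating u -> smooth_fields (s1 ++ X :: Y :: s2) ->
  u (s1 ++ (X + Y) :: s2) = u (s1 ++ X :: s2) + u (s1 ++ Y :: s2).
Proof.
move=> [ulin _] ss; have := ulin _ X Y s1 s2 (@smooth_fun1 _ _ M) ss.
by rewrite !fscale1.
Qed.

Lemma alternatingZ (L : lmodType C) (u : seq (vector_field M) -> M -> L)
    (f : M -> C) (s1 : seq V) (X : V) (s2 : seq V) :
  Defs.alternating u -> smooth_fun setT f ->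
  u (fields s1 ++ fscale f (sfield_val X) :: fields s2) =
  fscale f (u (fields s1 ++ sfield_val X :: fields s2)).
Proof.
move=> uA fs; have [ulin _] := uA.
have ss : smooth_fields (fields s1 ++ sfield_val X :: sfield_val 0 :: fields s2).
  have := @smooth_fields_fields _ _ _ (s1 ++ X :: 0 :: s2).
  by rewrite map_cat.
have u0 : u (fields s1 ++ sfield_val 0 :: fields s2) = 0.
  have ss0 : smooth_fields (fields s1 ++ sfield_val 0 :: sfield_val 0 :: fields s2).
    have := @smooth_fields_fields _ _ _ (s1 ++ 0 :: 0 :: s2 : seq V).
    by rewrite map_cat.
  have := alternatingD uA ss0; rewrite sfield0 addr0 => /eqP.
  by rewrite -subr_eq0 opprD addrA subrr sub0r oppr_eq0 => /eqP.
have := ulin f X 0 (fields s1) (fields s2) fs.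
rewrite addr0 -(@sfield0 _ _ M) => -> //.
by rewrite u0 addr0.
Qed.

Definition lift_form (w : diff_form M) : seq V -> W := fun s => mk_fun (w (fields s)).

Lemma aform_lift (w : diff_form M) : is_form w -> aform (lift_form w).
Proof.
move=> [wA ws].
have wE s : lift_form w s = w (fields s) :> (M -> C).
  by apply/esym; exact: lifts_form.
have wD : multiadditive (lift_form w).
  move=> s1 X Y s2; apply: sfun_inj; rewrite sfunD !wE !map_cat /= sfieldD.
  apply: (alternatingD wA); have := @smooth_fields_fields _ _ _ (s1 ++ X :: Y :: s2).
  by rewrite map_cat.
split=> // s1 X Y s2.
have w0 Z : lift_form w (s1 ++ Z :: Z :: s2) = 0.
  apply: sfun_inj; rewrite wE sfun0 map_cat /=.
  have [_ w0] := wA; apply: (w0 _ (fields s1) [::] (fields s2)).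
  by have := @smooth_fields_fields _ _ _ (s1 ++ Z :: Z :: s2); rewrite map_cat.
apply/eqP; rewrite -addr_eq0; apply/eqP.
(* Polarization: expanding the zero value on [X + Y] taken twice leaves the two mixed terms. *)
have := w0 (X + Y); rewrite wD.
have := wD (s1 ++ [:: X]) X Y s2; rewrite -!catA /= => E1.
have := wD (s1 ++ [:: Y]) X Y s2; rewrite -!catA /= => E2.
by rewrite E1 E2 !w0 add0r addr0.
Qed.

(** Both arguments are function multiples of [zeta]; once the functions are pulled out, [zeta] is a
    repeated argument. *)
Lemma kills2_lift (w : diff_form M) : is_form w -> kills2 SP (lift_form w).
Proof.
move=> wF s1 X s2 Y s3; have [wA ws] := wF.
have wE s : lift_form w s = w (fields s) :> (M -> C).
  by apply/esym; exact: lifts_form.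
apply: sfun_inj; rewrite wE sfun0 map_cat /= map_cat /=.
have [f fs ->] := zeta_coefficient X; have [g gs ->] := zeta_coefficient Y.
pose Z : V := mk_field zeta; have ZE : sfield_val Z = zeta by exact: mk_fieldK.
pose gZ : V := mk_field (fscale g zeta).
have gZE : sfield_val gZ = fscale g zeta.
  by apply: mk_fieldK; apply: smooth_fieldZ => //; exact: openT.
have := alternatingZ s1 Z (s2 ++ gZ :: s3) wA fs; rewrite map_cat /= ZE gZE => ->.
have := alternatingZ (s1 ++ Z :: s2) Z s3 wA gs.
rewrite map_cat /= -!catA /= ZE => ->.
have [_ w0] := wA; rewrite w0.
  by apply/funext => p; rewrite /fscale !scaler0.
have := @smooth_fields_fields _ _ _ (s1 ++ Z :: s2 ++ Z :: s3).
by rewrite !map_cat /= map_cat /= ZE.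
Qed.

Section vector_valued.
Variable u : vform M.
Hypothesis uS : vform_section (conj_subspaces T0) (Tprime T0 zeta) 1 u.

Definition lift_vform : seq V -> V := fun s => mk_field (u (fields s)).

Lemma lift_vformE : vlifts u lift_vform.
Proof.
move=> s; rewrite mk_fieldK//; have [_ uE _ _] := uS.
by have [] := uE _ (@smooth_fields_fields _ _ _ s).
Qed.

Lemma lift_vformD : {morph (fun X => lift_vform [:: X]) : X Y / X + Y}.
Proof.
move=> X Y; apply: sfield_inj; rewrite sfieldD -!lift_vformE /= sfieldD.
have [uA _ _ _] := uS; apply: (alternatingD (s1 := [::]) (s2 := [::]) uA).
exact: (@smooth_fields_fields _ _ _ [:: X; Y]).
Qed.

Lemma lift_vform_val X : SP iB (lift_vform [:: X]) = lift_vform [:: X].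
Proof.
apply: sfield_inj; rewrite SPE; apply/funext => p.
rewrite (project_id m_eq T0_bundle T0_conj zeta_transversal)// -lift_vformE.
have [_ uE _ _] := uS.
by have [_] := uE _ (@smooth_fields_fields _ _ _ [:: X]); exact.
Qed.

Lemma lift_vform_arg k X : k != iT -> lift_vform [:: SP k X] = 0.
Proof.
move=> kT; apply: sfield_inj; rewrite -lift_vformE sfield0.
have [_ _ _ u0] := uS; apply: (u0 _ 0%N) => //.
  exact: (@smooth_fields_fields _ _ _ [:: SP k X]).
split=> [|p _] /=; first exact: sfieldP.
rewrite SPE; apply: submx_trans (project_sub _ _ _ _ _) _.
case: k kT => [[|[|[|//]]] k3] kT /=.
- by rewrite genmxE addsmxSr.
- exact: addsmxSl.
- by case/eqP: kT; exact: val_inj.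
Qed.

End vector_valued.

Lemma vform_section_imath_inv omega q (w : diff_form M) :
  vform_section (conj_subspaces T0) (Tprime T0 zeta) q (imath_inv T0 zeta omega q w).
Proof.
rewrite /imath_inv; case: xgetP => [u _ []//|_].
split=> //.
- split=> // f X Y s1 s2 _ _.
  by apply/funext => p; rewrite /fscale /= [RHS]addr0 [RHS]scaler0.
- by move=> s _; split=> [|p _]; [exact: smooth_field0|exact: sub0mx].
Qed.

Lemma lifts_vbracket (u v : vform M) :
  vform_section (conj_subspaces T0) (Tprime T0 zeta) 1 u ->
  vform_section (conj_subspaces T0) (Tprime T0 zeta) 1 v ->
  vlifts (vbracket T0 zeta u v)
    (bracket_form SP (@slie R m M) (lift_vform u) (lift_vform v)).
Proof.
move=> uS vS [|X [|Y [|Z s]]]; rewrite /bracket_form /= ?sfield0//.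
have L := lift_vformE uS; have L' := lift_vformE vS.
rewrite !(sfieldD, sfieldN) !slieE -!L -!L' /= !(sfieldD, SPE) !slieE.
by rewrite -!L -!L' /= !SPE.
Qed.

Lemma bracket_contraction (u v : vform M) (rho : diff_form M) :
  vform_section (conj_subspaces T0) (Tprime T0 zeta) 1 u ->
  vform_section (conj_subspaces T0) (Tprime T0 zeta) 1 v ->
  is_form rho ->
  let d' := dprime T0 zeta in
  eq_form (contract_form 2 (vbracket T0 zeta u v) rho)
    (contract_form 1 u (d' (contract_form 1 v rho))
     + contract_form 1 v (d' (contract_form 1 u rho))
     - d' (contract_form 1 v (contract_form 1 u rho))
     - contract_form 1 v (contract_form 1 u (d' rho))).
Proof.
move=> uS vS rF d' s ss; rewrite -(smooth_fields_seq ss); move: (map _ s) => t.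
have rL : lifts rho (lift_form rho) by apply: lifts_form; have [] := rF.
have Lu := lift_vformE uS; have Lv := lift_vformE vS.
have dL w z : lifts w z -> lifts (d' w) (dprime_sum SP (@sact R m M) (@slie R m M) z).
  by move=> wz; exact: (lifts_dprime sm_proj wz).
rewrite (lifts_contraction 2 (lifts_vbracket uS vS) rL).
rewrite (contraction_bracket sprojectD sproject_sum sprojectP sactDl sactDr slieDl slieDr slieC
  (lift_vformD uS) (lift_vformD vS) (lift_vform_val uS) (lift_vform_val vS)
  (lift_vform_arg uS) (lift_vform_arg vS) slieBB t (aform_lift rF) (kills2_lift rF)).
rewrite !(sfunD, sfunN); congr (_ + _ - _ - _); apply/esym.
- by apply: lifts_contraction => //; apply: dL; exact: lifts_contraction.
- by apply: lifts_contraction => //; apply: dL; exact: lifts_contraction.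
- by apply: dL; apply: lifts_contraction => //; exact: lifts_contraction.
- by do 2!apply: lifts_contraction => //; exact: dL.
Qed.

End cr_forms.

Theorem lemma1p3 (R : realType) (n : nat) (M : manifold R (2 * n).-1)
    (T0 : subspaces M) (zeta : vector_field M)
    (omega alpha beta rho : diff_form M) :
  (7 <= (2 * n).-1)%N ->
  cr_structure n T0 ->
  normal_strongly_pseudoconvex T0 zeta ->
  trivializing_section n T0 zeta omega ->
  Apq T0 zeta n.-2 1 alpha ->
  Apq T0 zeta n.-2 1 beta ->
  Tprime_form T0 rho ->
  let phi := imath_inv T0 zeta omega 1 alpha in
  let psi := imath_inv T0 zeta omega 1 beta in
  let d' := dprime T0 zeta in
  eq_form
    (contract_form 2 (vbracket T0 zeta phi psi) rho)
    (contract_form 1 phi (d' (contract_form 1 psi rho))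
     + contract_form 1 psi (d' (contract_form 1 phi rho))
     - d' (contract_form 1 psi (contract_form 1 phi rho))
     - contract_form 1 psi (contract_form 1 phi (d' rho))).
Proof.
move=> n7 [_ _ T0b T0c T0l] [zs _ zt _ _] _ _ _ [rF _] phi psi d'.
(* With truncated predecessors this fails at [n = 0], which the bound on the dimension excludes. *)
have m_eq : (2 * n).-1 = (n.-1 + (n.-1 + 1))%N.
  by case: n n7 {M T0 zeta omega alpha beta rho T0b T0c T0l zs zt rF phi psi d'} => // k _;
    rewrite mul2n -addnn addnS addn1 /= addSn addnS.
apply: (bracket_contraction m_eq T0b T0c T0l zs zt) => //.
  exact: vform_section_imath_inv.
exact: vform_section_imath_inv.
Qed.
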